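(* Let $T$ be a sublinear operator acting on measurable functions on $\mathbb{R}^n$, and let $k\in\mathbb{N}$ and $C>0$ be such that, for every $u\in A_1$, the operator $T:L^1(u)\to L^{1,\infty}(u)$ is bounded with constant less than or equal to $C\|u\|_{A_1}^k$. Then there is a constant $C'>0$ such that, for every $t>0$ and every measurable function $f$, $$(Tf)^*(t)\le C'\left(\frac1t\int_0^t f^*(s)\,ds+\int_t^\infty\left(1+\log\frac st\right)^{k-1}f^*(s)\,\frac{ds}{s}\right).$$
   Context: $\mathbb{N}=\{1,2,\dots\}$. The Hardy-Littlewood maximal operator on $\mathbb{R}^n$ is $Mf(x)=\sup_{Q\ni x}\frac1{|Q|}\int_Q|f(y)|\,dy$, the supremum being over all cubes $Q\subseteq\mathbb{R}^n$ containing $x$. A weight $u$ (a nonnegative locally integrable function on $\mathbb{R}^n$) belongs to $A_1$ if there is a constant $c$ with $Mu(x)\le c\,u(x)$ for a.e. $x$; $\|u\|_{A_1}$ is the infimum of all such $c$. $L^1(u)$ and $L^{1,\infty}(u)$ are the Lebesgue and weak Lebesgue spaces for the measure $u(x)\,dx$, with $\|g\|_{L^{1,\infty}(u)}=\sup_{y>0}y\,u(\{|g|>y\})$. The decreasing rearrangement of $f$ with respect to Lebesgue measure is $f^*(t)=\inf\{s>0:\lambda_f(s)\le t\}$, where $\lambda_f(s)=|\{|f|>s\}|$.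
   Formalization: The bound is claimed for measurable f lying in L^1(u) for some nonzero u in A_1, or for every measurable f if T is countably subadditive over measurable partitions; for merely finitely sublinear T and arbitrary measurable f the claim is false. *)

(* Defs.v *)
From HB Require Import structures.
From mathcomp Require Import all_boot all_order all_algebra.
From mathcomp Require Import all_classical all_reals all_analysis.
From mathcomp Require Import measurable_realfun.

Set Implicit Arguments.
Unset Strict Implicit.
Unset Printing Implicit Defensive.

Import Order.TTheory GRing.Theory Num.Theory.
Import numFieldNormedType.Exports.

Local Open Scope classical_set_scope.
Local Open Scope ring_scope.

(* R^n is [n.-tuple R] with its product (Borel) sigma-algebra.  The library
   has no Lebesgue measure there, so it is built as an iterated product. *)
Section lebesgue_cons.
Context (R : realType) (n : nat).
Variable m : {sigma_finite_measure set (n.-tuple R) -> \bar R}.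

Definition tuple_cons (p : measurableTypeR R * n.-tuple R) : n.+1.-tuple R :=
  [tuple of (p.1 : R) :: p.2].

Lemma measurable_tuple_cons : measurable_fun setT tuple_cons.
Proof.
apply: (@measurable_cons _ _ _ R (fun p : measurableTypeR R * n.-tuple R => p.1 : R)).
  exact: (@measurable_fst _ _ (measurableTypeR R) (n.-tuple R)).
exact: measurable_snd.
Qed.

Definition lebesgue_cons : set (n.+1.-tuple R) -> \bar R :=
  pushforward (@lebesgue_measure R \x m)%E tuple_cons.

Let pm : {measure set (n.+1.-tuple R) -> \bar R} :=
  measure_function_pushforward__canonical__measure_function_Measure
    (@lebesgue_measure R \x m)%E measurable_tuple_cons.

HB.instance Definition _ := isMeasure.Build _ _ _ lebesgue_cons
  (measure0 pm) (measure_ge0 pm) (@measure_semi_sigma_additive _ _ _ pm).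

Lemma lebesgue_consE (A : set R) (B : set (n.-tuple R)) :
  measurable A -> measurable B ->
  lebesgue_cons [set x | A (thead x) /\ B [tuple of behead x]] =
  (@lebesgue_measure R A * m B)%E.
Proof.
move=> mA mB; rewrite -(product_measure1E _ m) //.
rewrite /lebesgue_cons /pushforward; congr (_ _).
apply/seteqP; split => -[x y] /=.
  by rewrite theadE (_ : [tuple of _] = y)//; exact: val_inj.
by rewrite theadE (_ : [tuple of _] = y)//; exact: val_inj.
Qed.

Lemma lebesgue_cons_sigma_finite : sigma_finite setT lebesgue_cons.
Proof.
have /sigma_finiteP[F [FT ndF mF]] := sigma_finiteT (@lebesgue_measure R).
have /sigma_finiteP[G [GT ndG mG]] := sigma_finiteT m.
exists (fun i => [set x | F i (thead x) /\ G i [tuple of behead x]]).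
  apply/seteqP; split => // x _.
  have [i _ Fi] : (\bigcup_i F i) (thead x) by rewrite -FT.
  have [j _ Gj] : (\bigcup_i G i) [tuple of behead x] by rewrite -GT.
  exists (maxn i j) => //; split.
    by have /subsetPset := ndF _ _ (leq_maxl i j); exact.
  by have /subsetPset := ndG _ _ (leq_maxr i j); exact.
move=> i; have [mFi Fi] := mF i; have [mGi Gi] := mG i; split.
  apply: (@measurableI _ _ [set x | F i (thead x)]).
    rewrite -[X in measurable X]setTI.
    exact: (@measurable_tnth _ R n.+1 ord0).
  by rewrite -[X in measurable X]setTI; exact: measurable_behead.
rewrite lebesgue_consE //; apply: lte_mul_pinfty => //.
by rewrite ge0_fin_numE.
Qed.

HB.instance Definition _ := @Measure_isSigmaFinite.Build _ _ _ lebesgue_cons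
  lebesgue_cons_sigma_finite.

End lebesgue_cons.

Fixpoint lebesgue_tuple (R : realType) (n : nat) :
    {sigma_finite_measure set (n.-tuple R) -> \bar R} :=
  match n with
  | 0 => \d_([tuple] : 0.-tuple R)
  | n'.+1 => lebesgue_cons (lebesgue_tuple R n')
  end.

Definition cube (R : realType) (n : nat) (a : n.-tuple R) (l : R) :
    set (n.-tuple R) :=
  [set x | forall i, tnth a i <= tnth x i <= tnth a i + l].

Lemma measurable_cube (R : realType) (n : nat) (a : n.-tuple R) (l : R) :
  measurable (cube a l).
Proof.
have -> : cube a l = \bigcap_(i in [set: 'I_n])
    ((fun x : n.-tuple R => tnth x i) @^-1` `[tnth a i, tnth a i + l]).
  by apply/seteqP; split => x /= H i; have := H i; rewrite /= in_itv/= => ->.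
apply: fin_bigcap_measurable => // i _.
by rewrite -[X in measurable X]setTI; exact: measurable_tnth.
Qed.

Lemma lebesgue_cube (R : realType) (n : nat) (a : n.-tuple R) (l : R) :
  0 <= l -> lebesgue_tuple R n (cube a l) = (l ^+ n)%:E.
Proof.
move=> l0; elim: n => [|n IH] in a *.
  rewrite /= diracE mem_set ?expr0//= => -[]//.
have tnthL (x : n.+1.-tuple R) i :
    tnth [tuple of behead x] i = tnth x (lift ord0 i).
  by rewrite [in RHS](tuple_eta x) tnthS.
have -> : cube a l = [set x | `[thead a, thead a + l]%classic (thead x) /\
    cube [tuple of behead a] l [tuple of behead x]].
  apply/seteqP; split => x /=.
    move=> H; split; first by have := H ord0; rewrite /= in_itv.
    by move=> i; rewrite !tnthL; exact: H.
  rewrite in_itv/= => -[H0 H] i.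
  have [<-//|i0] := eqVneq ord0 i.
  by have [j -> _] := unlift_some i0; rewrite -!tnthL.
rewrite [LHS](lebesgue_consE (lebesgue_tuple R n)) ?IH//; last exact: measurable_cube.
rewrite lebesgue_measure_itv/= lte_fin.
case: ltP => [_|]; first by rewrite -EFinD addrAC subrr add0r exprS EFinM.
rewrite gerDl => l0'.
have -> : l = 0 by apply/eqP; rewrite eq_le l0 l0'.
by rewrite mul0e exprS mul0r.
Qed.

Section weights.
Context (R : realType) (n : nat).
Local Notation Rn := (n.-tuple R).
Local Notation mu := (lebesgue_tuple R n).
Implicit Types (f u : Rn -> R) (g : Rn -> \bar R) (T : (Rn -> R) -> Rn -> \bar R).
Local Open Scope ereal_scope.

Definition maximal f (x : Rn) : \bar R :=
  ereal_sup [set y | exists a l, [/\ (0 < l)%R, cube a l x &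
    y = (mu (cube a l))^-1 * \int[mu]_(z in cube a l) `|f z|%:E]].

(* Every bounded set lies in a cube, so integrability on cubes is local
   integrability. *)
Definition weight u :=
  [/\ measurable_fun [set: Rn] u, forall x, (0 <= u x)%R &
    forall a l, \int[mu]_(x in cube a l) (u x)%:E < +oo].

Definition A1_bound u (c : R) :=
  (0 <= c)%R /\ {ae mu, forall x, maximal u x <= (c * u x)%:E}.

Definition A1 u := weight u /\ exists c, A1_bound u c.

Definition A1_norm u : R := inf [set c | A1_bound u c].

Definition L1_norm u f : \bar R := \int[mu]_x (`|f x| * u x)%:E.

Definition in_L1 u f := measurable_fun [set: Rn] f /\ L1_norm u f < +oo.

Definition weak_L1_norm u g : \bar R :=
  ereal_sup [set y%:E * \int[mu]_(x in [set x | y%:E < `|g x|]) (u x)%:E |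
    y in [set y : R | (0 < y)%R]].

Definition weak_L1_bounded T u (c : R) :=
  forall f, in_L1 u f -> weak_L1_norm u (T f) <= c%:E * L1_norm u f.

(* Values in \bar R, so that operators such as [maximal] are covered. *)
Definition sublinear_operator T :=
  [/\ forall f, measurable_fun [set: Rn] f -> measurable_fun [set: Rn] (T f),
    forall f h, measurable_fun [set: Rn] f -> measurable_fun [set: Rn] h ->
      {ae mu, forall x, `|T (f \+ h)%R x| <= `|T f x| + `|T h x|} &
    forall (a : R) f, measurable_fun [set: Rn] f ->
      {ae mu, forall x, `|T (fun z => a * f z)%R x| = `|a|%:E * `|T f x|}].

(* Boundedness on the spaces L^1(u) and finite subadditivity say nothing about
   T on functions lying in no L^1(u): [T f = `|l f|], with l a linear
   functional on measurable functions vanishing on the union of these spaces,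
   is sublinear and zero on each of them, while the rearrangement bound can be
   finite off the union, e.g. for (log (e + |x|))^-(k+1).  The estimate is
   therefore stated for f in the union of the L^1(u), where the hypothesis
   defines T, and for every measurable f if T is countably subadditive.  The
   zero weight is excluded since every measurable function is in its L^1. *)
Definition in_A1_domain f :=
  exists u, [/\ A1 u, ~ {ae mu, forall x, u x = 0%R} & in_L1 u f].

Definition countably_subadditive T :=
  forall f (A : (set Rn)^nat), measurable_fun [set: Rn] f ->
    (forall j, measurable (A j)) -> trivIset setT A -> \bigcup_j A j = setT ->
    {ae mu, forall x,
      `|T f x| <= \sum_(0 <= j <oo) `|T (fun z => f z * \1_(A j) z)%R x|}.

Definition distribution_function g (s : R) : \bar R :=
  mu [set x | s%:E < `|g x|].

Definition rearrangement g (t : R) : \bar R :=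
  ereal_inf [set s%:E | s in
    [set s : R | (0 < s)%R /\ distribution_function g s <= t%:E]].

End weights.

(* Main.v *)
Require Import Defs.
From HB Require Import structures.
From mathcomp Require Import all_boot all_order all_algebra.
From mathcomp Require Import all_classical all_reals all_analysis.
From mathcomp Require Import measurable_realfun.
From mathcomp Require Import ring lra.

(* Split f at the levels f^*(s_j), s_j = t 2^(2^j - 1).  The part above f^*(t)
   is handled by the weak type (1,1) for u = 1.  The part f_j of f between the
   levels f^*(s_(j+1)) and f^*(s_j) satisfies |f_j| <= f^*(s_j) and is supported
   in a set of measure at most s_(j+1).  For functions g with |g| <= lam \1_A,
   the estimate (Tg)^*(tau) <= c lam (1 + log (|A| / tau))^k holds: given a set
   E of measure at least tau inside {|Tg| > y}, test the hypothesis on the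
   weight \1_E + M^-1 max(2^-M, maximal function of \1_E), M ~ log (|A| / tau);
   it is at least 1 on E, its A_1 norm is O(M) because averaging the truncated
   maximal function costs a factor M, and its integral over A is O(|E|).  Used
   at tau = t 2^-(j+2), where the logarithm is still of size 2^j, this gives
   terms 2^(jk) f^*(s_j), each bounded by the integral of the logarithmic kernel
   over ]s_(j-1), s_j[. *)

Set Implicit Arguments.
Unset Strict Implicit.
Unset Printing Implicit Defensive.

Import Order.TTheory GRing.Theory Num.Theory.
Import numFieldNormedType.Exports.

Local Open Scope classical_set_scope.
Local Open Scope ring_scope.

(** * Cubes *)

(** The double exponential scale is what yields the exponent [k - 1]. On a geometric scale [t 2^j]
    the terms would be [(1 + j)^k f^*(t 2^j)], that is the kernel with exponent [k], one logarithm
    too many. On the scale [s_j] the kernel has size [2^(j(k-1))] on a whole interval, and the mass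
    of [ds/s] there supplies the missing factor [2^j]. The second obstacle is that weak [L^1] is not
    normed, so infinitely many pieces cannot simply be added: each piece gets its own share of the
    measure [t], and these shares sum to at most [t]. Halving the shares adds only a multiple of [j]
    to a logarithm already of size [2^j]. Finally, finite subadditivity leaves a remainder of [f]
    after each partial sum. It is removed qualitatively: its norm in the [L^1(u)] containing [f]
    tends to zero, so the [A_1] norm of that [u] never enters the constant. *)

Section cubes.
Context {R : realType} {n : nat}.
Local Notation Rn := (n.-tuple R).
Local Notation mu := (lebesgue_tuple R n).
Implicit Types (E G : set Rn) (a b : Rn) (l : R) (p q : Rn * R).

(** Cubes are coded as a corner and a side; this is the concentric cube with three times the side,
    as in Vitali's covering lemma. *)
Definition dilate_cube p : Rn * R :=
  ([tuple tnth p.1 i - p.2 | i < n], 3 * p.2).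

Lemma sub_dilate_cube p q : 0 <= q.2 <= p.2 ->
  cube p.1 p.2 `&` cube q.1 q.2 !=set0 ->
  cube q.1 q.2 `<=` cube (dilate_cube p).1 (dilate_cube p).2.
Proof.
case: p => a l; case: q => b r /=.
move=> /andP[q0 qp] [y [yp yq]] x xq i; rewrite tnth_mktuple.
have /andP[? ?] := yp i; have /andP[? ?] := yq i; have /andP[? ?] := xq i.
by apply/andP; split; lra.
Qed.

Lemma cube_rat_cover a l : 0 < l -> exists p : n.-tuple rat * rat,
  let b := [tuple ratr (tnth p.1 i) | i < n] in
  [/\ 0 < ratr p.2 :> R, ratr p.2 <= 2 * l & cube a l `<=` cube b (ratr p.2)].
Proof.
move=> l0.
(* The corner moves back by less than [l / 2] in each coordinate, so a side above [3 / 2 * l] still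
   reaches past [a + l]. *)
have [r /itvP r1] := @rat_in_itvoo R (3 / 2 * l) (2 * l) ltac:(lra).
have /choice[b bP] i : exists q : rat, ratr q \in `](tnth a i - l / 2), (tnth a i)[.
  by apply: rat_in_itvoo; lra.
have r32 : 3 / 2 * l < ratr r by rewrite r1.
exists ([tuple b i | i < n], r); split => /=.
- lra.
- by rewrite r1.
- move=> x xa i; rewrite !tnth_mktuple.
  have /andP[? ?] := xa i; have := bP i; rewrite in_itv/= => /andP[? ?].
  by apply/andP; split; lra.
Qed.

(** A countable substitute for all cubes: averages of [\1_E] are controlled by averages over members
    up to a dimensional factor, and level sets become countable unions, hence measurable. *)
Definition cube_family (e : nat -> Rn * R) :=
  (forall i, 0 < (e i).2) /\
  forall a l, 0 < l -> exists2 i, (e i).2 <= 2 * l &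
    cube a l `<=` cube (e i).1 (e i).2.

Lemma cube_family_exists : exists e, cube_family e.
Proof.
(* Indices that code nothing, or code a nonpositive side, fall back on a unit cube, since every
   member must have positive side. *)
pose d i : n.-tuple rat * rat := odflt ([tuple 0 | i < n], 1) (unpickle i).
pose e i : Rn * R := let p := d i in
  if 0 < (ratr p.2 : R) then ([tuple ratr (tnth p.1 i) | i < n], ratr p.2)
  else (([tuple 0 | i < n], 1)).
exists e; split=> [i|a l l0].
  by rewrite /e; case: ifPn.
have [p [p0 pl ap]] := @cube_rat_cover a l l0.
by exists (pickle p); rewrite /e /d pickleK/= p0.
Qed.

Definition cube_mass E p : R := fine (mu (E `&` cube p.1 p.2)).

Lemma mu_cube p : 0 <= p.2 -> mu (cube p.1 p.2) = (p.2 ^+ n)%:E.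
Proof. exact: lebesgue_cube. Qed.

Lemma cube_massE E p : measurable E -> 0 <= p.2 ->
  mu (E `&` cube p.1 p.2) = (cube_mass E p)%:E.
Proof.
move=> mE p0; rewrite fineK// ge0_fin_numE//.
rewrite (@le_lt_trans _ _ (mu (cube p.1 p.2)))//; last by rewrite mu_cube// ltry.
apply: le_measure; rewrite ?inE//; last exact: measurable_cube.
by apply: measurableI => //; exact: measurable_cube.
Qed.

Lemma cube_mass_ge0 E p : 0 <= cube_mass E p.
Proof. exact: fine_ge0. Qed.

Lemma cube_mass_le E p : measurable E -> 0 <= p.2 -> cube_mass E p <= p.2 ^+ n.
Proof.
move=> mE p0; rewrite -lee_fin -cube_massE// -mu_cube//.
apply: le_measure; rewrite ?inE//; last exact: measurable_cube.
by apply: measurableI => //; exact: measurable_cube.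
Qed.

Lemma le_cube_mass E p q : measurable E -> 0 <= p.2 -> 0 <= q.2 ->
  cube p.1 p.2 `<=` cube q.1 q.2 -> cube_mass E p <= cube_mass E q.
Proof.
move=> mE p0 q0 pq; rewrite -lee_fin -!cube_massE//.
by apply: le_measure; rewrite ?inE//;
  [apply: measurableI => //; exact: measurable_cube..|exact: setIS].
Qed.

(* Vitali's greedy selection; removing the largest cube from G at each step
   replaces the bookkeeping of a disjoint subfamily. *)
Lemma cube_cover_seq (c : R) (s : seq (Rn * R)) G : measurable G -> 0 <= c ->
  (forall p, p \in s -> 0 < p.2 /\ p.2 ^+ n <= c * cube_mass G p) ->
  (mu (\big[setU/set0]_(p <- s) cube p.1 p.2) <= (3 ^+ n * c)%:E * mu G)%E.
Proof.
move=> mG c0; have [m] := ubnP (size s); elim: m s G mG => // m IH s G mG sm sG.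
have [->|s0] := eqVneq s [::].
  by rewrite big_nil measure0 mule_ge0// lee_fin mulr_ge0// exprn_ge0.
have [p ps pmax] : exists2 p, p \in s & forall q, q \in s -> q.2 <= p.2.
  case: s s0 {sm sG} => // p0 s _.
  elim: s p0 => [|q s ih] p0.
    by exists p0; [rewrite mem_head|move=> q; rewrite inE => /eqP ->].
  have [p ps pmax] := ih p0.
  have [qp|pq] := leP q.2 p.2.
    exists p; first by move: ps; rewrite !inE => /orP[->//|->]; rewrite !orbT.
    move=> r; rewrite !inE => /or3P[/eqP->|/eqP->//|rs].
    - by apply: pmax; rewrite mem_head.
    - by apply: pmax; rewrite inE rs orbT.
  exists q; first by rewrite !inE eqxx orbT.
  move=> r; rewrite !inE => /or3P[/eqP->|/eqP->//|rs].
  - by apply: ltW; apply: le_lt_trans pq; apply: pmax; rewrite mem_head.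
  - by apply: ltW; apply: le_lt_trans pq; apply: pmax; rewrite inE rs orbT.
have [p0 pG] := sG p ps.
pose meets q := `[< cube p.1 p.2 `&` cube q.1 q.2 !=set0 >].
pose s' := [seq q <- s | ~~ meets q].
have ps' : meets p.
  apply/asboolP; exists p.1; split=> i; rewrite lexx lerDl; lra.
have s'm : (size s' < m)%N.
  rewrite -ltnS; apply: leq_trans sm; rewrite ltnS size_filter.
  rewrite -(count_predC meets s) -addn1 addnC leq_add2r//.
  by rewrite -has_count; apply/hasP; exists p.
pose G' := G `\` cube p.1 p.2.
have mcube q : measurable (cube q.1 q.2) by exact: measurable_cube.
have mG' : measurable G' by exact: measurableD.
have /IH - /(_ G' mG') : (size s' < m)%N by [].
(* The cubes kept do not meet [p], so removing [p] from [G] leaves their mass unchanged. *)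
have s'G q : q \in s' -> 0 < q.2 /\ q.2 ^+ n <= c * cube_mass G' q.
  rewrite mem_filter => /andP[/asboolPn npq /sG[q0 qG]]; split => //.
  rewrite (le_trans qG)// le_eqVlt; apply/orP; left; apply/eqP.
  congr (_ * fine (mu _)); apply/seteqP; split => x [xG xq]; split => //; last by case: xG.
  by split => // xp; apply: npq; exists x.
move=> /(_ s'G) {IH} IH.
have mbig (r : seq (Rn * R)) : measurable (\big[setU/set0]_(p <- r) cube p.1 p.2).
  by apply: bigsetU_measurable => q _; exact: mcube.
(* A cube that meets [p] is no larger than [p], hence lies in its triple. *)
have sub : \big[setU/set0]_(p <- s) cube p.1 p.2 `<=`
    cube (dilate_cube p).1 (dilate_cube p).2 `|` \big[setU/set0]_(p <- s') cube p.1 p.2.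
  rewrite -!bigcup_seq => x [q /= qs xq].
  have [/asboolP mq|nq] := boolP (meets q).
    left; apply: sub_dilate_cube xq => //.
    by rewrite pmax// andbT ltW//; case: (sG q qs).
  by right; exists q => //=; rewrite mem_filter nq.
have d0 : 0 <= (dilate_cube p).2 by rewrite /=; lra.
apply: (@le_trans _ _ (mu (cube (dilate_cube p).1 (dilate_cube p).2 `|`
    \big[setU/set0]_(p <- s') cube p.1 p.2))).
  by apply: le_measure; rewrite ?inE//; exact: measurableU.
apply: (le_trans (measureU2 _ _ _)) => //.
(* The part of [G] inside [p] pays for the triple of [p], the rest pays for the remaining cubes. *)
have -> : mu G = (mu (G `&` cube p.1 p.2) + mu G')%E.
  by rewrite addeC -measureDI.
rewrite ge0_muleDr//; apply: leeD => //.
rewrite [leLHS](mu_cube d0) (cube_massE mG (ltW p0)) -EFinM lee_fin exprMn -mulrA.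
by rewrite ler_wpM2l// exprn_ge0.
Qed.

End cubes.

(** * The test weights *)

Section dense_set.
Context {R : realType} {n : nat}.
Local Notation Rn := (n.-tuple R).
Local Notation mu := (lebesgue_tuple R n).
Variable e : nat -> Rn * R.
Hypothesis eP : cube_family e.
Implicit Types (E : set Rn) (p q : Rn * R).

(* The set where the maximal function of [\1_E] along the cubes [e i] exceeds
   [2 ^- m]. *)
Definition dense_set E (m : nat) : set Rn :=
  \bigcup_(i in [set i | (e i).2 ^+ n < 2 ^+ m * cube_mass E (e i)])
    cube (e i).1 (e i).2.

Lemma measurable_dense_set E m : measurable (dense_set E m).
Proof. by apply: bigcup_measurable => i _; exact: measurable_cube. Qed.

(** Weak type (1,1) of the maximal function at height [2 ^- m]: [cube_cover_seq] with [c = 2 ^+ m]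
    bounds the union of the selected cubes among the first [N], and [N] tends to infinity. *)
Lemma mu_dense_set E m : measurable E ->
  (mu (dense_set E m) <= (3 ^+ n * 2 ^+ m)%:E * mu E)%E.
Proof.
move=> mE; have [e0 _] := eP.
pose P i := (e i).2 ^+ n < 2 ^+ m * cube_mass E (e i).
pose F N := \big[setU/set0]_(p <- [seq e i | i <- iota 0 N & P i]) cube p.1 p.2.
have FE N x : F N x <-> exists i, [/\ (i < N)%N, P i & cube (e i).1 (e i).2 x].
  rewrite /F -bigcup_seq; split=> [[p /= /mapP[i]]|[i [iN Pi xi]]].
    by rewrite mem_filter mem_iota add0n => /andP[Pi /andP[_ iN]] -> xi; exists i.
  by exists (e i) => //=; apply/mapP; exists i; rewrite // mem_filter mem_iota Pi.
have DF : dense_set E m = \bigcup_N F N.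
  apply/seteqP; split=> [x [i Pi xi]|x [N _ /FE[i [_ Pi xi]]]]; last by exists i.
  by exists i.+1 => //; apply/FE; exists i.
have mF N : measurable (F N).
  by apply: bigsetU_measurable => p _; exact: measurable_cube.
have cvgF : mu (F N) @[N --> \oo] --> mu (dense_set E m).
  rewrite DF; apply: nondecreasing_cvg_mu => //; first exact: bigcup_measurable.
  move=> N N' NN'; apply/subsetPset => x /FE[i [iN Pi xi]].
  by apply/FE; exists i; split => //; exact: leq_trans NN'.
rewrite -(cvg_lim _ cvgF)//; apply: lime_le; first by apply/cvg_ex; eexists; exact: cvgF.
apply: nearW => N; apply: cube_cover_seq => // p /mapP[i].
by rewrite mem_filter => /andP[Pi _] ->; split; [exact: e0|exact: ltW].
Qed.

(** Localization of one level set to a cube [p] around [x]. A dense cube that meets [p] and is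
    larger than [p] has a slightly larger neighbour containing [x], which puts [x] in the level set
    of index [m + 3 * n]; then the trivial bound is used. Otherwise only smaller cubes matter, they
    see only the part of [E] in the triple of [p], and the weak type applies to that part. *)
Lemma dense_set_cube E m p x : measurable E -> 0 < p.2 -> cube p.1 p.2 x ->
  (mu (dense_set E m `&` cube p.1 p.2) <=
   (3 ^+ n * 2 ^+ m * cube_mass E (dilate_cube p)
    + p.2 ^+ n * \1_(dense_set E (m + 3 * n)) x)%:E)%E.
Proof.
move=> mE p0 px; have [e0 ecov] := eP.
have mQ : measurable (cube p.1 p.2) by exact: measurable_cube.
set p3 := dilate_cube p.
have p30 : 0 <= p3.2 by rewrite /=; lra.
have mG : measurable (E `&` cube p3.1 p3.2).
  by apply: measurableI => //; exact: measurable_cube.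
have mD E' : measurable (dense_set E' m `&` cube p.1 p.2).
  by apply: measurableI => //; exact: measurable_dense_set.
have c0 : 0 <= 3 ^+ n * 2 ^+ m * cube_mass E p3.
  by rewrite !mulr_ge0 ?exprn_ge0 ?cube_mass_ge0.
have [xD|nxD] := pselect (dense_set E (m + 3 * n) x).
  rewrite indicE mem_set// mulr1.
  apply: (@le_trans _ _ (mu (cube p.1 p.2))).
    by apply: le_measure; rewrite ?inE.
  by rewrite (mu_cube (ltW p0)) lee_fin lerDr.
rewrite indicE memNset// mulr0 addr0.
apply: (@le_trans _ _ (mu (dense_set (E `&` cube p3.1 p3.2) m))); last first.
  by apply: (le_trans (mu_dense_set m mG)); rewrite (cube_massE mE p30) -EFinM.
apply: le_measure; rewrite ?inE//; first exact: measurable_dense_set.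
move=> y [[i /= Pi yi] yp]; exists i => //=.
have [lip|pli] := leP (e i).2 p.2.
  suff -> : cube_mass (E `&` cube p3.1 p3.2) (e i) = cube_mass E (e i) by [].
  congr (fine (mu _)); apply/seteqP; split => z [Ez zi].
    by split => //; case: Ez.
  split => //; split => //; apply: (@sub_dilate_cube _ _ p (e i)) => //.
    by rewrite lip andbT ltW.
  by exists y.
exfalso; apply: nxD.
have := ecov (dilate_cube (e i)).1 (dilate_cube (e i)).2.
have ei0 := e0 i.
case=> [|j jl ij]; first by rewrite /=; lra.
have pi3 : cube p.1 p.2 `<=` cube (dilate_cube (e i)).1 (dilate_cube (e i)).2.
  apply: sub_dilate_cube; first by rewrite !ltW.
  by exists y.
have ii3 : cube (e i).1 (e i).2 `<=` cube (dilate_cube (e i)).1 (dilate_cube (e i)).2.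
  apply: sub_dilate_cube; first by rewrite lexx ltW.
  by exists y.
exists j => /=; last by apply: ij; exact: pi3.
(* The side grows by 3 for the dilation and by 2 for the passage to the family; 6 is rounded up to 8
   so that the loss is the power of two [2 ^+ (3 * n)]. *)
have l6 : (e j).2 ^+ n <= 8 ^+ n * (e i).2 ^+ n.
  rewrite -exprMn; apply: lerXn2r; rewrite ?nnegrE ?mulr_ge0 ?(ltW (e0 _))//.
  by apply: (le_trans jl); rewrite /=; lra.
apply: (le_lt_trans l6).
rewrite exprD mulrAC mulrC exprM (_ : 2 ^+ 3 = 8 :> R); last by ring.
rewrite ltr_pM2r ?exprn_gt0//; apply: (lt_le_trans Pi).
rewrite ler_wpM2l ?exprn_ge0// le_cube_mass ?ltW//.
exact: subset_trans ii3 ij.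
Qed.

(* Comparable to the maximum of [2 ^- M] and the maximal function of [\1_E]. *)
Definition dense_sum E (M : nat) (x : Rn) : R :=
  2 ^- M + \sum_(m < M) 2 ^- m * \1_(dense_set E m) x.

(** Valid also for [m >= M], where the constant [2 ^- M] takes over; this is needed for the shifted
    index [m + 3 * n]. *)
Lemma dense_sum_ge E M m x : dense_set E m x -> 2 ^- m <= dense_sum E M x.
Proof.
move=> xm; rewrite /dense_sum; have s0 (A : pred 'I_M) :
    0 <= \sum_(m < M | A m) 2 ^- m * \1_(dense_set E m) x.
  by apply: sumr_ge0 => i _; rewrite mulr_ge0 ?invr_ge0 ?exprn_ge0.
have [mM|Mm] := ltnP m M.
  rewrite (bigD1 (Ordinal mM))//= indicE mem_set// mulr1 addrCA lerDl.
  by rewrite addr_ge0 ?invr_ge0 ?exprn_ge0.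
rewrite (@le_trans _ _ (2 ^- M))// ?lerDl//.
by rewrite lef_pV2 ?posrE ?exprn_gt0// ler_eXn2l// ltr1n.
Qed.

Lemma dense_sum_ge_cst E M x : 2 ^- M <= dense_sum E M x.
Proof.
rewrite lerDl; apply: sumr_ge0 => i _.
by rewrite mulr_ge0 ?invr_ge0 ?exprn_ge0.
Qed.

Lemma dense_sum_gt0 E M x : 0 < dense_sum E M x.
Proof. by apply: lt_le_trans (dense_sum_ge_cst _ _ _); rewrite invr_gt0 exprn_gt0. Qed.

Lemma dense_sum_le E M x : dense_sum E M x <= M%:R + 1.
Proof.
rewrite addrC; have le1 m : 2 ^- m <= 1 :> R.
  by rewrite invf_le1 ?exprn_gt0// exprn_ege1// ler1n.
apply: lerD => //.
have -> : M%:R = \sum_(m < M) 1 :> R by rewrite sumr_const card_ord.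
by apply: ler_sum => i _; rewrite -[leRHS]mul1r ler_pM ?invr_ge0 ?exprn_ge0.
Qed.

Lemma measurable_dense_sum E M : measurable_fun setT (dense_sum E M).
Proof.
apply: measurable_funD => //; apply: measurable_sum => i.
by apply: measurable_funM => //; apply: measurable_indic; exact: measurable_dense_set.
Qed.

(** If [m] is the least index for which the average of [\1_E] exceeds [2 ^- m], the failure of
    [m - 1] bounds that average by [2 * 2 ^- m]. *)
Lemma cube_mass_dense_sum E M i x : measurable E -> (0 < M)%N ->
  cube (e i).1 (e i).2 x -> cube_mass E (e i) <= 2 * dense_sum E M x * (e i).2 ^+ n.
Proof.
move=> mE M0 xi; have [e0 _] := eP; have l0 : 0 < (e i).2 ^+ n by rewrite exprn_gt0.
set P := fun m => (e i).2 ^+ n < 2 ^+ m * cube_mass E (e i).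
have [exP|nP] := pselect (exists m, P m); last first.
  (* No level is exceeded: the failure of the level [M - 1] already gives the bound by the constant
     term. *)
  have : ~ P M.-1 by move=> PM; apply: nP; exists M.-1.
  rewrite /P => /negP; rewrite -leNgt => h.
  apply: (@le_trans _ _ (2 * 2 ^- M * (e i).2 ^+ n)); last first.
    by rewrite ler_wpM2r ?(ltW l0)// ler_wpM2l// dense_sum_ge_cst.
  rewrite -(prednK M0) exprS invfM mulrA divff ?pnatr_eq0// mul1r.
  by rewrite mulrC ler_pdivlMr ?exprn_gt0// mulrC.
(* The least index is not 0, because an average of [\1_E] is at most 1. *)
case: (ex_minnP exP) => -[|m] Pm mmin.
  have := cube_mass_le mE (ltW (e0 i)).
  by move: Pm; rewrite /P expr0 mul1r => /lt_le_trans h /h; rewrite ltxx.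
have : ~~ P m by apply/negP => /mmin; rewrite ltnn.
rewrite /P -leNgt => h.
have xm : dense_set E m.+1 x by exists i.
apply: (@le_trans _ _ (2 * 2 ^- m.+1 * (e i).2 ^+ n)); last first.
  by rewrite ler_wpM2r ?(ltW l0)// ler_wpM2l// dense_sum_ge.
rewrite exprS invfM mulrA divff ?pnatr_eq0// mul1r.
by rewrite mulrC ler_pdivlMr ?exprn_gt0// mulrC.
Qed.

Lemma cube_mass_dilate E M p x : measurable E -> (0 < M)%N -> 0 < p.2 ->
  cube p.1 p.2 x ->
  cube_mass E (dilate_cube p) <= 2 * 6 ^+ n * dense_sum E M x * p.2 ^+ n.
Proof.
move=> mE M0 p0 xp; have [e0 ecov] := eP.
have := ecov (dilate_cube p).1 (dilate_cube p).2.
case=> [|j jl pj]; first by rewrite /=; lra.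
have xj : cube (e j).1 (e j).2 x.
  apply: pj; apply: (@sub_dilate_cube _ _ p p) => //; first by rewrite lexx ltW.
  by exists x.
apply: (@le_trans _ _ (cube_mass E (e j))).
  by apply: le_cube_mass => //; [rewrite /=; lra|exact: ltW].
apply: (le_trans (cube_mass_dense_sum mE M0 xj)).
rewrite [leRHS]mulrAC [leRHS](_ : _ = 2 * dense_sum E M x * (6 ^+ n * p.2 ^+ n)); last by ring.
rewrite ler_wpM2l ?(mulr_ge0 _ (ltW (dense_sum_gt0 _ _ _)))// -exprMn.
apply: lerXn2r; rewrite ?nnegrE ?mulr_ge0 ?(ltW p0) ?(ltW (e0 _))//.
by apply: (le_trans jl); rewrite /=; lra.
Qed.

Definition dense_weight E (M : nat) (x : Rn) : R :=
  \1_E x + M%:R^-1 * dense_sum E M x.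

Lemma dense_weight_ge0 E M x : 0 <= dense_weight E M x.
Proof. by rewrite addr_ge0// mulr_ge0 ?invr_ge0// ltW// dense_sum_gt0. Qed.

Lemma measurable_dense_weight E M : measurable E ->
  measurable_fun setT (dense_weight E M).
Proof.
move=> mE; apply: measurable_funD; first exact: measurable_indic.
by apply: measurable_funM => //; exact: measurable_dense_sum.
Qed.

Lemma integral_dense_weight E M A : measurable E -> measurable A ->
  (\int[mu]_(x in A) (dense_weight E M x)%:E =
   mu (E `&` A) + M%:R^-1%:E * ((2 ^- M)%:E * mu A +
     \sum_(m < M) (2 ^- m)%:E * mu (dense_set E m `&` A)))%E.
Proof.
move=> mE mA; have mI B : measurable B -> measurable_fun A (fun x => (\1_B x : R)%:E).
  move=> mB; apply/measurable_EFinP.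
  by apply: measurable_funTS; exact: measurable_indic.
have mS : measurable_fun A (fun x => (dense_sum E M x)%:E).
  by apply/measurable_EFinP; apply: measurable_funTS; exact: measurable_dense_sum.
under eq_integral do rewrite /dense_weight EFinD EFinM.
have S0 x : A x -> (0 <= (dense_sum E M x)%:E)%E by rewrite lee_fin ltW// dense_sum_gt0.
have M0 : (0 <= M%:R^-1 :> R) by rewrite invr_ge0.
rewrite ge0_integralD; [|by []|by move=> x _; rewrite lee_fin|exact: (mI _ mE)|
  by move=> x Ax; rewrite mule_ge0 ?S0// lee_fin|exact: measurable_funeM].
rewrite integral_indic// ge0_integralZl_EFin//; congr (_ + _ * _)%E.
under eq_integral do rewrite /dense_sum EFinD -sumEFin.
have mT (i : 'I_M) : measurable_fun A (fun x => (2 ^- i * \1_(dense_set E i) x)%:E).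
  apply/measurable_EFinP; apply: measurable_funM => //.
  by apply: measurable_funTS; apply: measurable_indic; exact: measurable_dense_set.
have T0 (i : 'I_M) x : (0 <= (2 ^- i * \1_(dense_set E i) x)%:E)%E.
  by rewrite lee_fin mulr_ge0 ?invr_ge0 ?exprn_ge0.
rewrite ge0_integralD; [|by []|by move=> x _; rewrite lee_fin invr_ge0 exprn_ge0|
  exact: measurable_cst|by move=> x _; apply: sume_ge0|exact: emeasurable_sum].
rewrite integral_cst//; congr (_ + _)%E.
rewrite ge0_integral_sum; [|by []|exact: mT|by move=> i x _; exact: T0].
apply: eq_bigr => m _.
have mD : measurable (dense_set E m) by exact: measurable_dense_set.
rewrite -(integral_indic mu mA mD) -ge0_integralZl_EFin//.
exact: mI.
Qed.

(** The height [2 ^- m] of a level cancels the [2 ^+ m] of its weak type bound, so each of the [M]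
    levels contributes at most [3 ^+ n] times the measure of [E], and [M^-1] averages them. The
    constant 2 counts [\1_E] and the floor [2 ^- M], which is harmless by the assumption on [A]. *)
Lemma integral_dense_weight_le E M A : measurable E -> measurable A -> (0 < M)%N ->
  ((2 ^- M)%:E * mu A <= mu E)%E ->
  (\int[mu]_(x in A) (dense_weight E M x)%:E <= (2 + 3 ^+ n)%:E * mu E)%E.
Proof.
move=> mE mA M0 AE; rewrite integral_dense_weight//.
have mono B : measurable B -> (mu (B `&` A) <= mu B)%E.
  by move=> mB; apply: le_measure; rewrite ?inE//; exact: measurableI.
have term (m : 'I_M) : ((2 ^- m)%:E * mu (dense_set E m `&` A) <= (3 ^+ n)%:E * mu E)%E.
  apply: (@le_trans _ _ ((2 ^- m)%:E * ((3 ^+ n * 2 ^+ m)%:E * mu E))%E).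
    rewrite lee_wpmul2l ?lee_fin ?invr_ge0 ?exprn_ge0//.
    apply: le_trans (mu_dense_set m mE).
    by apply: mono; exact: measurable_dense_set.
  rewrite muleA -EFinM mulrC mulfK// ?expf_neq0 ?pnatr_eq0//.
have M1 : (M%:R^-1 <= 1 :> R) by rewrite invf_le1 ?ltr0n// ler1n.
have -> : ((2 + 3 ^+ n)%:E * mu E = mu E + (mu E + (3 ^+ n)%:E * mu E))%E.
  rewrite EFinD ge0_muleDl ?lee_fin ?exprn_ge0// (_ : 2%:E = 1 + 1)%E//.
  by rewrite ge0_muleDl// mul1e addeA.
apply: leeD; first exact: mono.
rewrite ge0_muleDr; last 2 first.
- by rewrite mule_ge0// lee_fin invr_ge0 exprn_ge0.
- by apply: sume_ge0 => i _; rewrite mule_ge0// lee_fin invr_ge0 exprn_ge0.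
apply: leeD.
  rewrite -[leRHS]mul1e; apply: lee_pmul => //; rewrite ?lee_fin ?invr_ge0//.
  by rewrite mule_ge0// lee_fin invr_ge0 exprn_ge0.
apply: (@le_trans _ _ (M%:R^-1%:E * (M%:R%:E * ((3 ^+ n)%:E * mu E)))%E).
  rewrite lee_wpmul2l ?lee_fin ?invr_ge0//.
  apply: (le_trans (lee_sum _ (fun i _ => term i))).
  by rewrite sumr_const card_ord mule_natl.
by rewrite muleA -EFinM mulVf ?pnatr_eq0 -?lt0n// mul1e.
Qed.

(** The factor [1 + 3 ^+ n] collects the mass of [E] in the triple cube, from [\1_E] and from the
    levels; 1 comes from the floor [2 ^- M], and [8 ^+ n] from the levels that contain [x] after the
    shift by [3 * n]. *)
Definition A1_cst : R := 2 * 6 ^+ n * (1 + 3 ^+ n) + 1 + 8 ^+ n.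

Lemma A1_cst_gt0 : 0 < A1_cst.
Proof.
by rewrite /A1_cst; do ![apply: addr_gt0|apply: mulr_gt0|apply: exprn_gt0].
Qed.

(** Both the average of [\1_E] and the localized average of each level, at its height, are bounded
    by a constant times [V], the value of [dense_sum] at [x]. The factor [M^-1] compensates the
    number of levels, so the loss of [M] occurs only in [V <= M * dense_weight]. *)
Lemma dense_weight_cube E M p x : measurable E -> (0 < M)%N -> 0 < p.2 ->
  cube p.1 p.2 x ->
  (\int[mu]_(z in cube p.1 p.2) (dense_weight E M z)%:E <=
   (A1_cst * M%:R * dense_weight E M x * p.2 ^+ n)%:E)%E.
Proof.
move=> mE M0 p0 xp; have [e0 ecov] := eP.
have M0' : 0 < M%:R :> R by rewrite ltr0n.
set V := dense_sum E M x; set m3 := cube_mass E (dilate_cube p).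
have V0 : 0 < V by exact: dense_sum_gt0.
have m3V : m3 <= 2 * 6 ^+ n * V * p.2 ^+ n by exact: cube_mass_dilate.
have m30 : 0 <= m3 by exact: cube_mass_ge0.
have pn0 : 0 < p.2 ^+ n by rewrite exprn_gt0.
have wV : V <= M%:R * dense_weight E M x.
  by rewrite /dense_weight mulrDr mulrA divff ?gt_eqF// mul1r lerDr mulr_ge0// ltW.
rewrite integral_dense_weight//; last exact: measurable_cube.
have mass : (mu (E `&` cube p.1 p.2) <= m3%:E)%E.
  rewrite -cube_massE//; last by rewrite /=; lra.
  apply: le_measure; rewrite ?inE; try by apply: measurableI => //; exact: measurable_cube.
  apply: setIS; apply: sub_dilate_cube; first by rewrite lexx ltW.
  by exists x.
have term (m : 'I_M) : ((2 ^- m)%:E * mu (dense_set E m `&` cube p.1 p.2) <=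
    (3 ^+ n * m3 + 8 ^+ n * V * p.2 ^+ n)%:E)%E.
  apply: (le_trans (lee_wpmul2l _ (dense_set_cube m mE p0 xp))).
    by rewrite lee_fin invr_ge0 exprn_ge0.
  have t0 : 0 < 2 ^+ m :> R by rewrite exprn_gt0.
  rewrite -EFinM lee_fin mulrDr; apply: lerD.
    by rewrite -/m3 -mulrA mulrCA mulKf ?gt_eqF.
  (* If [x] lies in the shifted level set, then [2 ^- (m + 3 * n) <= V], that is
     [2 ^- m <= 8 ^+ n * V]. *)
  have [xD|nxD] := pselect (dense_set E (m + 3 * n) x); last first.
    by rewrite indicE memNset// !mulr0 !mulr_ge0// ?exprn_ge0// ltW.
  rewrite indicE mem_set// mulr1 ler_wpM2r ?(ltW pn0)//.
  have := dense_sum_ge M xD; rewrite exprD exprM (_ : 2 ^+ 3 = 8 :> R); last by ring.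
  rewrite -/V invfM => h.
  apply: (@le_trans _ _ (8 ^+ n * (2 ^- m / 8 ^+ n))).
    by rewrite mulrC divfK// expf_neq0// pnatr_eq0.
  by rewrite ler_wpM2l// exprn_ge0.
apply: (@le_trans _ _ (m3%:E + M%:R^-1%:E * ((2 ^- M)%:E * (p.2 ^+ n)%:E +
    (M%:R * (3 ^+ n * m3 + 8 ^+ n * V * p.2 ^+ n))%:E))%E).
  apply: leeD => //; apply: lee_wpmul2l; first by rewrite lee_fin invr_ge0.
  apply: leeD; first by rewrite (mu_cube (ltW p0)).
  apply: (le_trans (lee_sum _ (fun i _ => term i))).
  by rewrite sumEFin sumr_const card_ord mulr_natl.
rewrite -!(EFinM, EFinD) lee_fin mulrDr.
rewrite [X in _ + (_ + X)]mulrA mulVf ?gt_eqF// mul1r.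
have VM : 2 ^- M <= V by exact: dense_sum_ge_cst.
have small : M%:R^-1 * (2 ^- M * p.2 ^+ n) <= V * p.2 ^+ n.
  rewrite -[leRHS]mul1r; apply: ler_pM.
  - by rewrite invr_ge0.
  - by rewrite mulr_ge0 ?invr_ge0 ?exprn_ge0// ltW.
  - by rewrite invf_le1// ler1n.
  - by rewrite ler_wpM2r// ltW.
apply: (@le_trans _ _ (A1_cst * V * p.2 ^+ n)); last first.
  by rewrite ler_wpM2r ?(ltW pn0)// -mulrA ler_wpM2l// ltW// A1_cst_gt0.
have t0 : 0 <= 3 ^+ n :> R by rewrite exprn_ge0.
have : (1 + 3 ^+ n) * m3 <= (1 + 3 ^+ n) * (2 * 6 ^+ n * V * p.2 ^+ n).
  by rewrite ler_wpM2l// addr_ge0.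
rewrite /A1_cst; move: small; set a := 6 ^+ n; set b := 3 ^+ n; set c := 8 ^+ n; set d := p.2 ^+ n.
set s := M%:R^-1 * _; move=> ? ?; nra.
Qed.

Lemma dense_weight_A1_bound E M : measurable E -> (0 < M)%N ->
  A1_bound (dense_weight E M) (A1_cst * M%:R).
Proof.
move=> mE M0; split; first by rewrite mulr_ge0// ltW// A1_cst_gt0.
apply: aeW => x; apply: ub_ereal_sup => _ [a [l [l0 xQ ->]]].
rewrite (@lebesgue_cube R n a l (ltW l0)).
have := @dense_weight_cube E M (a, l) x mE M0 l0 xQ => /=.
under eq_integral do rewrite -[dense_weight _ _ _]ger0_norm ?dense_weight_ge0//.
move=> h; rewrite inver (gt_eqF (exprn_gt0 n l0)).
apply: (le_trans (lee_wpmul2l _ h)); first by rewrite lee_fin invr_ge0 exprn_ge0// ltW.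
by rewrite -EFinM lee_fin mulrC mulfK// expf_neq0// gt_eqF.
Qed.

Lemma weight_dense_weight E M : measurable E -> weight (dense_weight E M).
Proof.
move=> mE; split; first exact: measurable_dense_weight.
  exact: dense_weight_ge0.
move=> a l.
have mQ : measurable (cube a l) by exact: measurable_cube.
pose b : R := 1 + M%:R^-1 * (M%:R + 1).
have b0 : 0 <= b by rewrite addr_ge0// mulr_ge0 ?invr_ge0// addr_ge0.
apply: (@le_lt_trans _ _ (\int[mu]_(x in cube a l) b%:E)%E).
  apply: ge0_le_integral => //.
  - by move=> x _; rewrite lee_fin dense_weight_ge0.
  - by apply/measurable_EFinP; apply: measurable_funTS; exact: measurable_dense_weight.
  - move=> x _; rewrite lee_fin; apply: lerD.
      by rewrite indicE; case: (_ \in _).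
    by rewrite ler_wpM2l ?invr_ge0// dense_sum_le.
rewrite integral_cst// lte_mul_pinfty ?lee_fin//.
(* The definition of [weight] ranges over all real [l], also negative ones, whereas [lebesgue_cube]
   asks for a nonnegative side. *)
apply: (@le_lt_trans _ _ (mu (cube a `|l|))); last by rewrite lebesgue_cube// ltry.
apply: le_measure; rewrite ?inE//; first exact: measurable_cube.
by move=> x xQ i; have /andP[-> h]/= := xQ i; rewrite (le_trans h)// lerD2l ler_norm.
Qed.

Lemma A1_dense_weight E M : measurable E -> (0 < M)%N ->
  A1 (dense_weight E M) /\ 0 <= A1_norm (dense_weight E M) <= A1_cst * M%:R.
Proof.
move=> mE M0; have bd := dense_weight_A1_bound mE M0.
split; first by split; [exact: weight_dense_weight|exists (A1_cst * M%:R)].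
have lb0 : lbound [set c | A1_bound (dense_weight E M) c] 0 by move=> c [].
apply/andP; split.
  by apply: lb_le_inf => //; exists (A1_cst * M%:R).
by apply: ge_inf => //; exists 0.
Qed.

End dense_set.

(** * Rearrangements *)

Section rearrangement.
Context {R : realType} {n : nat}.
Local Notation Rn := (n.-tuple R).
Local Notation mu := (lebesgue_tuple R n).
Implicit Types (g : Rn -> \bar R) (t s y : R) (A B : set Rn).
Local Open Scope ereal_scope.

(** Cubes of finite measure increasing to the whole space; the shift of the index keeps the side
    positive, as [maximal] requires. *)
Definition centered_cube (x : Rn) (N : nat) : set Rn :=
  cube [tuple (tnth x i - N.+1%:R)%R | i < n] (2 * N.+1%:R)%R.

Lemma measurable_centered_cube x N : measurable (centered_cube x N).
Proof. exact: measurable_cube. Qed.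

Lemma centered_cube_fin x N : mu (centered_cube x N) < +oo.
Proof. by rewrite lebesgue_cube ?ltry// mulr_ge0. Qed.

Lemma centered_cube_center x N : centered_cube x N x.
Proof.
move=> i; rewrite tnth_mktuple; have : (0 < N.+1%:R :> R)%R by rewrite ltr0n.
by move=> ?; apply/andP; split; lra.
Qed.

Lemma nondecreasing_centered_cube x :
  {homo centered_cube x : N N' / (N <= N')%N >-> (N <= N')%O}.
Proof.
move=> N N' NN'; apply/subsetPset => z xz i; have := xz i; rewrite !tnth_mktuple.
have : (N.+1%:R <= N'.+1%:R :> R)%R by rewrite ler_nat.
by move=> ? /andP[? ?]; apply/andP; split; lra.
Qed.

Lemma bigcup_centered_cube x : \bigcup_N centered_cube x N = setT.
Proof.
apply/seteqP; split => // z _.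
pose S : R := (\sum_(i < n) `|tnth z i - tnth x i|)%R.
have Sge i : (`|tnth z i - tnth x i| <= S)%R.
  by rewrite /S (bigD1 i)//= lerDl sumr_ge0.
have S0 : (0 <= S)%R by rewrite sumr_ge0.
exists (Num.bound S) => // i; rewrite tnth_mktuple.
have := archi_boundP S0; rewrite -[(Num.bound S).+1%:R]natr1.
have := Sge i; rewrite ler_norml => /andP[? ?] ?.
by apply/andP; split; lra.
Qed.

(** Used by contraposition: a set of measure above [t], possibly infinite, has a piece of finite
    measure still above [t]. *)
Lemma measure_exhaustion x B (t : \bar R) : measurable B ->
  (forall N, mu (B `&` centered_cube x N) <= t) -> mu B <= t.
Proof.
move=> mB h.
have mF N : measurable (B `&` centered_cube x N).
  by apply: measurableI => //; exact: measurable_centered_cube.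
have BE : \bigcup_N (B `&` centered_cube x N) = B.
  by rewrite -setI_bigcupr bigcup_centered_cube setIT.
have cvgF : mu (B `&` centered_cube x N) @[N --> \oo] --> mu B.
  rewrite -[in mu B]BE; apply: nondecreasing_cvg_mu => //.
    by rewrite BE.
  move=> N N' NN'; apply/subsetPset; apply: setIS; apply/subsetPset.
  exact: nondecreasing_centered_cube.
rewrite -(cvg_lim _ cvgF)//; apply: lime_le; first by apply/cvg_ex; eexists; exact: cvgF.
exact: nearW.
Qed.

Lemma measurable_superlevel g y : measurable_fun setT g ->
  measurable [set x | y%:E < `|g x|].
Proof.
move=> mg; rewrite -[X in measurable X]setTI.
apply: emeasurable_fun_o_infty => //; exact: measurableT_comp.
Qed.

(** Right continuity of the distribution function: the superlevel set at [y] is the increasing union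
    of those at [y + N.+1%:R^-1]. *)
Lemma distribution_le g (y t : R) : measurable_fun setT g ->
  (forall s, (y < s)%R -> distribution_function g s <= t%:E) ->
  distribution_function g y <= t%:E.
Proof.
move=> mg h; pose F (N : nat) := [set x | (y + N.+1%:R^-1)%:E < `|g x|].
have key (a : \bar R) : y%:E < a -> exists N : nat, (y + N.+1%:R^-1)%:E < a.
  case: a => [r|_|]; [|by exists 0%N; rewrite ltry|by rewrite ltNge leNye].
  rewrite lte_fin => yr; have ry0 : (0 < r - y)%R by rewrite subr_gt0.
  exists (Num.bound (r - y)^-1); rewrite lte_fin -ltrBrDl.
  rewrite invf_plt ?posrE// (@lt_trans _ _ (Num.bound (r - y)^-1)%:R)//.
    by apply: archi_boundP; rewrite invr_ge0 ltW.
  by rewrite ltr_nat.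
have mF N : measurable (F N) by exact: measurable_superlevel.
have FE : \bigcup_N F N = [set x | y%:E < `|g x|].
  apply/seteqP; split=> [x [N _]|x]; rewrite /F/=.
    by apply: le_lt_trans; rewrite lee_fin lerDl.
  by move=> /key[N yN]; exists N.
have cvgF : mu (F N) @[N --> \oo] --> distribution_function g y.
  rewrite /distribution_function -FE; apply: nondecreasing_cvg_mu => //.
    by rewrite FE; exact: measurable_superlevel.
  move=> N N' NN'; apply/subsetPset => x; rewrite /F/=; apply: le_lt_trans.
  by rewrite lee_fin lerD2l lef_pV2 ?posrE// ler_nat.
rewrite -(cvg_lim _ cvgF)//; apply: lime_le; first by apply/cvg_ex; eexists; exact: cvgF.
by apply: nearW => N; apply: h; rewrite ltrDl.
Qed.

(** Right continuity means that the level [rearrangement g t] itself already satisfies the condition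
    whose infimum it is. *)
Lemma distribution_rearrangement g t y : measurable_fun setT g ->
  rearrangement g t <= y%:E -> distribution_function g y <= t%:E.
Proof.
move=> mg gt; apply: distribution_le => // s ys.
have : rearrangement g t < s%:E by rewrite (le_lt_trans gt) ?lte_fin.
move=> /ereal_inf_lt[_ [r [r0 dr] <-]]; rewrite lte_fin => rs.
apply: le_trans dr; apply: le_measure; rewrite ?inE; try exact: measurable_superlevel.
by move=> x /=; apply: lt_trans; rewrite lte_fin.
Qed.

Lemma rearrangement_le g t y : (0 <= y)%R ->
  (forall s, (y < s)%R -> distribution_function g s <= t%:E) ->
  rearrangement g t <= y%:E.
Proof.
move=> y0 h; apply/lee_addgt0Pr => e e0; rewrite -EFinD.
apply: ereal_inf_lbound; exists (y + e)%R => //; split.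
  by rewrite ltr_wpDl.
by apply: h; rewrite ltrDl.
Qed.

Lemma rearrangement_ge0 g t : 0 <= rearrangement g t.
Proof. by apply: le_ereal_inf_tmp => _ [s [s0 _] <-]; rewrite lee_fin ltW. Qed.

Lemma rearrangement_nonincreasing g t t' : (t <= t')%R ->
  rearrangement g t' <= rearrangement g t.
Proof.
move=> tt'; apply: ereal_inf_le_tmp => _ [s [s0 ds] <-]; exists s => //; split => //.
by apply: (le_trans ds); rewrite lee_fin.
Qed.

(** By monotonicity the preimages of rays are intervals. *)
Lemma measurable_rearrangement g (D : set R) : measurable D ->
  measurable_fun (D : set (measurableTypeR R)) (rearrangement g).
Proof.
move=> mD; apply: (@measurable_funS _ _ _ _ setT) => //.
apply: (measurability _ (@ErealGenCInfty.measurableE R)).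
move=> _ [_ [y ->] <-]; rewrite setTI.
apply: is_interval_measurable => a b /=; rewrite !in_itv/= !andbT.
move=> ay by_ c /andP[ac cb]; rewrite in_itv/= andbT.
by rewrite (le_trans by_)// rearrangement_nonincreasing.
Qed.

End rearrangement.

(** * Consequences of the weighted estimates *)

Section A1_weights.
Context {R : realType} {n : nat}.
Local Notation Rn := (n.-tuple R).
Local Notation mu := (lebesgue_tuple R n).
Implicit Types (u f : Rn -> R) (A : set Rn).
Local Open Scope ereal_scope.

Lemma A1_cst1 : A1 (cst 1%R : Rn -> R) /\ (0 <= A1_norm (cst 1%R : Rn -> R) <= 1)%R.
Proof.
have bd : A1_bound (cst 1%R : Rn -> R) 1.
  split=> //; apply: aeW => x; apply: ub_ereal_sup => _ [a [l [l0 _ ->]]].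
  under eq_integral do rewrite normr1.
  rewrite integral_cst; last exact: measurable_cube.
  have muQ := @lebesgue_cube R n a l (ltW l0).
  rewrite mul1e muQ [X in _ * X]muQ inver (gt_eqF (exprn_gt0 n l0))/= -EFinM.
  by rewrite mulVf ?mulr1// expf_neq0// gt_eqF.
split.
  split; last by exists 1%R.
  split=> // a l; rewrite [ltLHS](integral_cst mu (measurable_cube a l) 1).
  rewrite mul1e (@le_lt_trans _ _ (mu (cube a `|l|)))//; last by rewrite lebesgue_cube// ltry.
  apply: le_measure; rewrite ?inE; try exact: measurable_cube.
  by move=> x xQ i; have /andP[-> h]/= := xQ i; rewrite (le_trans h)// lerD2l ler_norm.
have lb0 : lbound [set c | A1_bound (cst 1%R : Rn -> R) c] 0%R by move=> c [].
apply/andP; split; first by apply: lb_le_inf => //; exists 1%R.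
by apply: ge_inf => //; exists 0%R.
Qed.

(* If [u] vanished at a point where [maximal u <= c * u], every average of [u]
   over a cube around that point would vanish. *)
Lemma A1_ae_gt0 u : A1 u -> ~ {ae mu, forall x, u x = 0%R} ->
  {ae mu, forall x, (0 < u x)%R}.
Proof.
move=> [[mu_ u0 _] [c [c0 mc]]] nz; move: mc; apply: filterS => x mx.
rewrite lt_neqAle u0 andbT; apply/eqP => ux; apply: nz.
have Q0 N : mu.-negligible ([set z | u z <> 0%R] `&` centered_cube x N).
  have mQ := measurable_centered_cube x N.
  have mE : measurable_fun (centered_cube x N) (EFin \o u).
    by apply: measurable_funTS; exact/measurable_EFinP.
  have I0 : \int[mu]_(z in centered_cube x N) `|(EFin \o u) z| = 0.
    apply/eqP; rewrite eq_le integral_ge0// andbT.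
    have l0 : (0 < 2 * N.+1%:R :> R)%R by rewrite mulr_gt0.
    have : maximal u x <= 0 by move: mx; rewrite -ux mulr0.
    apply: contraTT; rewrite -!ltNge => I0.
    apply: (@lt_le_trans _ _ ((mu (centered_cube x N))^-1 *
        \int[mu]_(z in centered_cube x N) `|u z|%:E)).
      rewrite mule_gt0// (@lebesgue_cube R n _ _ (ltW l0)) inver (gt_eqF (exprn_gt0 n l0)).
      by rewrite lte_fin invr_gt0 exprn_gt0.
    apply: ereal_sup_ubound; eexists; exists (2 * N.+1%:R)%R; split=> //.
    exact: centered_cube_center.
  have [Z [mZ Z0 ZS]] := (ae_eq_integral_abs mu mQ mE).1 I0.
  exists Z; split=> // z [uz Qz]; apply: ZS => /= /(_ Qz)/= -[].
  exact: uz.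
have : mu.-negligible (\bigcup_N ([set z | u z <> 0%R] `&` centered_cube x N)).
  exact: negligible_bigcup.
by rewrite -setI_bigcupr bigcup_centered_cube setIT.
Qed.

Lemma L1_norm_le u f A (lam : R) : measurable_fun setT u -> (forall x, (0 <= u x)%R) ->
  measurable_fun setT f -> measurable A -> (0 <= lam)%R ->
  (forall x, A x -> (`|f x| <= lam)%R) -> (forall x, ~ A x -> f x = 0%R) ->
  L1_norm u f <= lam%:E * \int[mu]_(x in A) (u x)%:E.
Proof.
move=> mu_ u0 mf mA l0 fA f0.
have -> : L1_norm u f = \int[mu]_(x in A) (`|f x| * u x)%:E.
  rewrite integral_mkcond /L1_norm; apply: eq_integral => x _; rewrite patchE.
  by case: ifPn => // /negP; rewrite inE => /f0 ->; rewrite normr0 mul0r.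
have mE : measurable_fun A (EFin \o u).
  by apply: measurable_funTS; exact/measurable_EFinP.
rewrite -ge0_integralZl_EFin//; last by move=> x _; rewrite lee_fin.
apply: ge0_le_integral => //.
- by move=> x _; rewrite lee_fin mulr_ge0.
- apply/measurable_EFinP; apply: measurable_funTS; apply: measurable_funM => //.
  exact: measurableT_comp.
- exact: measurable_funeM.
- by move=> x /fA fx; rewrite -EFinM lee_fin ler_wpM2r.
Qed.

End A1_weights.

(** * Weak type bounds for T obtained from the weight 1 and from the test weights *)

Section operator.
Context {R : realType} {n : nat}.
Local Notation Rn := (n.-tuple R).
Local Notation mu := (lebesgue_tuple R n).
Implicit Types (u f : Rn -> R) (A : set Rn).
Variables (T : (Rn -> R) -> Rn -> \bar R) (k : nat) (C : R).
Hypothesis mT : forall f, measurable_fun setT f -> measurable_fun setT (T f).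
Hypothesis C0 : 0 < C.
Hypothesis HT : forall u : Rn -> R, A1 u -> weak_L1_bounded T u (C * A1_norm u ^+ k).
Local Open Scope ereal_scope.

Lemma weak_type_A1 u f (y N : R) : A1 u -> (0 <= A1_norm u <= N)%R -> in_L1 u f ->
  (0 < y)%R ->
  y%:E * \int[mu]_(x in [set x | y%:E < `|T f x|]) (u x)%:E <=
  (C * N ^+ k)%:E * L1_norm u f.
Proof.
move=> uA /andP[u0 uN] uf y0.
have [[_ u_ge0 _] _] := uA.
apply: (@le_trans _ _ ((C * A1_norm u ^+ k)%:E * L1_norm u f)).
  apply: le_trans (HT uA uf); apply: ereal_sup_ubound.
  by exists y.
apply: lee_wpmul2r; first by apply: integral_ge0 => x _; rewrite lee_fin mulr_ge0.
rewrite lee_fin ler_wpM2l ?(ltW C0)// lerXn2r// nnegrE//.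
exact: le_trans uN.
Qed.

Lemma weak_type_lebesgue f (y c t : R) : measurable_fun setT f -> (0 < y)%R ->
  \int[mu]_x `|f x|%:E <= c%:E -> (C * c <= y * t)%R ->
  distribution_function (T f) y <= t%:E.
Proof.
move=> mf y0 fc cyt; have [A1_1 n1] := @A1_cst1 R n.
have L1E : L1_norm (cst 1%R) f = \int[mu]_x `|f x|%:E.
  by apply: eq_integral => x _; rewrite mulr1.
have fL1 : in_L1 (cst 1%R) f by split=> //; rewrite L1E (le_lt_trans fc)// ltry.
have := weak_type_A1 A1_1 n1 fL1 y0.
rewrite [X in _ * X <= _](integral_cst mu (measurable_superlevel y (mT mf)) 1).
rewrite mul1e expr1n mulr1 L1E => h.
rewrite -(lee_pmul2l (_ : y%:E \is a fin_num)) ?lte_fin//.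
apply: (le_trans h); apply: (@le_trans _ _ (C%:E * c%:E)).
  by rewrite lee_wpmul2l// lee_fin ltW.
by rewrite -!EFinM lee_fin.
Qed.

(** The first two factors come from [C * A1_norm u ^+ k] with norm at most [A1_cst * M], the last
    one from the integral of the test weight over [A]. *)
Definition restricted_cst : R := (C * @A1_cst R n ^+ k * (2 + 3 ^+ n))%R.

Lemma restricted_cst_ge0 : (0 <= restricted_cst)%R.
Proof.
rewrite !mulr_ge0 ?addr_ge0 ?exprn_ge0//; first exact: ltW.
by rewrite ltW// A1_cst_gt0.
Qed.

(** If the superlevel set at some [y] above the threshold had measure above [t], a piece [E] of it
    would satisfy [y |E| <= y * int_E u <= C (A1_cst M)^k lam * int_A u <= K M^k lam |E| < y |E|],
    where [u] is the test weight of [E] and [K] is [restricted_cst]. *)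
Lemma restricted_weak_type f A (lam t : R) (M : nat) :
  measurable_fun setT f -> measurable A -> (0 <= lam)%R ->
  (forall x, A x -> (`|f x| <= lam)%R) -> (forall x, ~ A x -> f x = 0%R) ->
  (0 < M)%N -> (0 < t)%R -> (2 ^- M)%:E * mu A <= t%:E ->
  distribution_function (T f) (restricted_cst * M%:R ^+ k * lam) <= t%:E.
Proof.
move=> mf mA l0 fA f0 M0 t0 At; apply: distribution_le; first exact: mT.
move=> y yK; rewrite leNgt; apply/negP => ty.
set B := [set x | y%:E < `|T f x|].
have mB : measurable B by apply: measurable_superlevel; exact: mT.
have y0 : (0 < y)%R.
  apply: le_lt_trans yK; apply: mulr_ge0 => //.
  by apply: mulr_ge0; [exact: restricted_cst_ge0|exact: exprn_ge0].
pose o : Rn := [tuple 0%R | i < n].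
have [N tN] : exists N, t%:E < mu (B `&` centered_cube o N).
  apply: contrapT => h; move: ty; apply/negP; rewrite -leNgt.
  apply: (measure_exhaustion (x := o) mB) => N; rewrite leNgt; apply/negP => tN.
  by apply: h; exists N.
set E := B `&` centered_cube o N in tN.
have mE : measurable E by apply: measurableI => //; exact: measurable_centered_cube.
(* The measure of [E] is to be cancelled at the end, so it must be finite as well as positive. *)
have Efin : mu E \is a fin_num.
  rewrite ge0_fin_numE//; apply: le_lt_trans (centered_cube_fin o N).
  apply: le_measure; rewrite ?inE//; first exact: measurable_centered_cube.
  by move=> x [].
have [e eP] := @cube_family_exists R n.
have [uA un] := A1_dense_weight eP mE M0.
set u := dense_weight e E M in uA un.
have u0 x : (0 <= u x)%R by exact: dense_weight_ge0.
have mu_ : measurable_fun setT u by exact: measurable_dense_weight.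
(* The floor of the weight is under control because [2 ^- M * mu A <= t < mu E]. *)
have uA_le : \int[mu]_(x in A) (u x)%:E <= (2 + 3 ^+ n)%:E * mu E.
  by apply: integral_dense_weight_le => //; rewrite (le_trans At)// ltW.
have fu : L1_norm u f <= lam%:E * ((2 + 3 ^+ n)%:E * mu E).
  apply: (le_trans (L1_norm_le mu_ u0 mf mA l0 fA f0)).
  by rewrite lee_wpmul2l// lee_fin.
have fL1 : in_L1 u f.
  split=> //; apply: (le_lt_trans fu).
  by rewrite -(fineK Efin) -!EFinM ltry.
have := weak_type_A1 uA un fL1 y0.
apply/negP; rewrite -ltNge.
apply: (@le_lt_trans _ _ ((C * (@A1_cst R n * M%:R) ^+ k)%:E *
    (lam%:E * ((2 + 3 ^+ n)%:E * mu E)))).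
  rewrite lee_wpmul2l// lee_fin mulr_ge0 ?(ltW C0)// exprn_ge0// mulr_ge0//.
  by rewrite ltW// A1_cst_gt0.
apply: (@lt_le_trans _ _ (y%:E * mu E)).
  have E0 : (0 < fine (mu E))%R.
    by rewrite -lte_fin fineK// (lt_trans _ tN)// lte_fin.
  rewrite -(fineK Efin) -!EFinM lte_fin.
  rewrite [ltLHS](_ : _ = restricted_cst * M%:R ^+ k * lam * fine (mu E))%R.
    by rewrite ltr_pM2r.
  by rewrite exprMn /restricted_cst; ring.
rewrite lee_wpmul2l ?lee_fin ?(ltW y0)//.
apply: (@le_trans _ _ (\int[mu]_(x in E) (u x)%:E)).
  rewrite -[leLHS]mul1e -integral_cst//; apply: ge0_le_integral => //.
  - by apply: measurable_funTS; exact/measurable_EFinP.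
  - move=> x Ex; rewrite lee_fin /u /dense_weight indicE mem_set// lerDl.
    by rewrite mulr_ge0 ?invr_ge0// ltW// dense_sum_gt0.
apply: ge0_subset_integral => //; last by move=> x [].
  by apply: measurable_funTS; exact/measurable_EFinP.
by move=> x _; rewrite lee_fin.
Qed.

End operator.

(** * Summing the pieces of a function *)

Section superposition.
Context {R : realType} {n : nat}.
Local Notation Rn := (n.-tuple R).
Local Notation mu := (lebesgue_tuple R n).
Implicit Types (u f : Rn -> R) (B : set Rn).
Variables (T : (Rn -> R) -> Rn -> \bar R) (k : nat) (C : R).
Hypothesis subT : sublinear_operator T.
Hypothesis C0 : 0 < C.
Hypothesis HT : forall u : Rn -> R, A1 u -> weak_L1_bounded T u (C * A1_norm u ^+ k).
Local Open Scope ereal_scope.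

Definition cut f B : Rn -> R := fun z => (f z * \1_B z)%R.

Lemma measurable_cut f B : measurable_fun setT f -> measurable B ->
  measurable_fun setT (cut f B).
Proof. by move=> mf mB; apply: measurable_funM => //; exact: measurable_indic. Qed.

Lemma cut_in f B x : B x -> cut f B x = f x.
Proof. by move=> Bx; rewrite /cut indicE mem_set// mulr1. Qed.

Lemma cut_out f B x : ~ B x -> cut f B x = 0%R.
Proof. by move=> Bx; rewrite /cut indicE memNset// mulr0. Qed.

(** Homogeneity with the scalar 0 makes T of the zero function vanish almost everywhere. *)
Lemma T_cut_eq0 f B : measurable_fun setT f -> (forall x, B x -> f x = 0%R) ->
  {ae mu, forall x, `|T (cut f B) x| = 0}.
Proof.
move=> mf fB; have [_ _ homT] := subT.
have -> : cut f B = (fun z => 0 * f z)%R.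
  apply/funext => z; rewrite mul0r; have [Bz|nBz] := pselect (B z).
    by rewrite cut_in// fB.
  by rewrite cut_out.
by apply: filterS (homT 0%R f mf) => x ->; rewrite normr0 mul0e.
Qed.

Variables (f : Rn -> R) (A : (set Rn)^nat).
Hypothesis mf : measurable_fun setT f.
Hypothesis mA : forall i, measurable (A i).
Hypothesis tA : trivIset setT A.
Hypothesis fA : forall x, ~ (\bigcup_i A i) x -> f x = 0%R.

Let rest (J : nat) : set Rn := \bigcap_(i in `I_J) ~` A i.

Let mrest J : measurable (rest J).
Proof. by apply: bigcap_measurableType => i _; exact: measurableC. Qed.

Let cut_rest J : cut f (rest J) = (cut f (A J) \+ cut f (rest J.+1))%R.
Proof.
apply/funext => x /=; have [rx|nrx] := pselect (rest J x); last first.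
  rewrite cut_out// [X in (_ + X)%R]cut_out ?addr0; last first.
    by move=> h; apply: nrx => i /= iJ; apply: h => /=; exact: ltnW.
  have [Ax|nAx] := pselect (A J x); last by rewrite cut_out.
  exfalso; apply: nrx => i /= iJ Aix.
  have iE : i = J by apply: tA => //; exists x.
  by rewrite iE ltnn in iJ.
rewrite cut_in//; have [Ax|nAx] := pselect (A J x).
  by rewrite cut_in// cut_out ?addr0// => h; exact: (h J (ltnSn J)).
rewrite cut_out// cut_in ?add0r// => i /=; rewrite ltnS leq_eqVlt => /orP[/eqP->//|].
exact: rx.
Qed.

Let ae_rest J : {ae mu, forall x,
  `|T f x| <= \sum_(i < J) `|T (cut f (A i)) x| + `|T (cut f (rest J)) x|}.
Proof.
have [_ addT _] := subT.
elim: J => [|J IH].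
  apply: aeW => x; rewrite big_ord0 add0e (_ : cut f (rest 0) = f)//.
  by apply/funext => z; rewrite cut_in.
have := addT (cut f (A J)) (cut f (rest J.+1)).
rewrite -cut_rest => /(_ (measurable_cut mf (mA J)) (measurable_cut mf (mrest _))) h.
apply: filterS2 IH h => x h1 h2; apply: (le_trans h1).
by rewrite big_ord_recr/= -addeA leeD2l.
Qed.

Variables (y tau : nat -> R) (Y t : R).
Hypothesis yY : forall J, (\sum_(i < J) y i <= Y)%R.
Hypothesis tau0 : forall i, (0 <= tau i)%R.
Hypothesis taut : forall J, (\sum_(i < J) tau i <= t)%R.
Hypothesis dist : forall i, distribution_function (T (cut f (A i))) (y i) <= (tau i)%:E.

(** The exceptional set: outside it all pieces are simultaneously below their thresholds [y i], so
    their sum is at most [Y], while its measure is at most the sum of the shares [tau i]. *)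
Let G : set Rn := \bigcup_i [set x | (y i)%:E < `|T (cut f (A i)) x|].

Let mTf B : measurable B -> measurable_fun setT (T (cut f B)).
Proof. by have [mT _ _] := subT; move=> mB; apply: mT; exact: measurable_cut. Qed.

Let mG : measurable G.
Proof. by apply: bigcup_measurable => i _; apply: measurable_superlevel; exact: mTf. Qed.

Let muG : mu G <= t%:E.
Proof.
apply: (@le_trans _ _ (\sum_(0 <= i <oo) mu [set x | (y i)%:E < `|T (cut f (A i)) x|])).
  apply: measure_sigma_subadditive => // i; apply: measurable_superlevel; exact: mTf.
apply: (@le_trans _ _ (\sum_(0 <= i <oo) (tau i)%:E)).
  by apply: lee_nneseries => // i _; exact: dist.
apply: lime_le; first by apply: is_cvg_nneseries => i _ _; rewrite lee_fin.
by apply: nearW => J; rewrite big_mkord sumEFin lee_fin.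
Qed.

Let sum_out x : ~ G x -> forall J,
  \sum_(i < J) `|T (cut f (A i)) x| <= (\sum_(i < J) y i)%:E.
Proof.
move=> nGx J; rewrite -sumEFin; apply: lee_sum => i _.
by rewrite leNgt; apply/negP => h; apply: nGx; exists i.
Qed.

Let distribution_sum s : (Y < s)%R ->
  mu.-negligible ([set x | s%:E < `|T f x|] `\` G) ->
  distribution_function (T f) s <= t%:E.
Proof.
move=> Ys BG; have [mT _ _] := subT.
have mB : measurable [set x | s%:E < `|T f x|] by apply: measurable_superlevel; exact: mT.
apply: (@le_trans _ _ (mu (G `|` ([set x | s%:E < `|T f x|] `\` G)))).
  apply: le_measure; rewrite ?inE//; first by apply: measurableU => //; exact: measurableD.
  by move=> x Bx; have [Gx|nGx] := pselect (G x); [left|right].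
apply: (le_trans (measureU2 _ _ _)) => //; first exact: measurableD.
have BG0 : mu ([set x | s%:E < `|T f x|] `\` G) = 0.
  by apply/negligibleP => //; exact: measurableD.
by rewrite [X in _ + X]BG0 adde0.
Qed.

Let distribution_countably s : countably_subadditive T -> (Y < s)%R ->
  distribution_function (T f) s <= t%:E.
Proof.
move=> cT Ys; apply: distribution_sum => //.
(* Countable subadditivity needs a partition of the whole space, so the complement of the pieces is
   put in front; [f] vanishes there and T sends that part to zero. *)
pose A' i := if i is i'.+1 then A i' else ~` \bigcup_i A i.
have mA' i : measurable (A' i).
  by case: i => [|i] //=; apply: measurableC; exact: bigcup_measurable.
have tA' : trivIset setT A'.
  move=> [|i] [|j] _ _ //= [x [xi xj]].
  - by exfalso; apply: xi; exists j.
  - by exfalso; apply: xj; exists i.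
  - by congr S; apply: tA => //; exists x.
have UA' : \bigcup_i A' i = setT.
  apply/seteqP; split => // x _.
  have [[i _ Aix]|nA] := pselect ((\bigcup_i A i) x); last by exists 0%N.
  by exists i.+1.
have h0 : {ae mu, forall x, `|T (cut f (A' 0%N)) x| = 0} by apply: T_cut_eq0.
have [N [mN N0 NS]] := filterI h0 (cT f A' mf mA' tA' UA').
exists N; split=> // x [sx nGx]; apply: NS => /= -[x0 xs].
move: sx => /=; apply/negP; rewrite -leNgt; apply: (le_trans xs).
rewrite nneseries_recl// x0 add0e.
apply: lime_le; first exact: is_cvg_nneseries.
apply: nearW => -[|J]; first by
  rewrite big_nil lee_fin (le_trans _ (ltW Ys))// (le_trans _ (yY 0))// big_ord0.
rewrite big_add1/= big_mkord; apply: (le_trans (sum_out nGx J)).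
by rewrite lee_fin (le_trans (yY J))// ltW.
Qed.

(** Dominated convergence: a point in some [A i] leaves [rest J] once [J > i], and [f] is zero at
    all other points. *)
Let L1_rest u : weight u -> in_L1 u f ->
  L1_norm u (cut f (rest J)) @[J --> \oo] --> 0.
Proof.
move=> [mu_ u0 _] [_ fu].
have mfu B : measurable B -> measurable_fun setT (fun x => (`|cut f B x| * u x)%:E).
  move=> mB; apply/measurable_EFinP; apply: measurable_funM => //.
  by apply: measurableT_comp => //; exact: measurable_cut.
have mfu' : measurable_fun setT (fun x => (`|f x| * u x)%:E).
  apply/measurable_EFinP; apply: measurable_funM => //.
  exact: measurableT_comp.
rewrite -(@integral0 _ _ _ mu setT).
apply: (@dominated_cvg _ _ _ mu setT measurableT
  (fun J x => (`|cut f (rest J) x| * u x)%:E) (cst 0) (fun x => (`|f x| * u x)%:E)) => //.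
- by move=> J; apply: mfu.
- move=> x _; apply: cvg_near_cst.
  have [[i _ Aix]|nA] := pselect ((\bigcup_i A i) x); last first.
    by apply: nearW => J; rewrite /cut fA// mul0r normr0 mul0r.
  exists i.+1 => // J /= iJ; rewrite cut_out ?normr0 ?mul0r//.
  by move=> /(_ i); apply.
- apply/integrableP; split => //.
  rewrite (_ : \int[mu]_x _ = L1_norm u f)//.
  by apply: eq_integral => x _; rewrite gee0_abs// lee_fin mulr_ge0.
- move=> J x _; rewrite gee0_abs ?lee_fin ?mulr_ge0// ler_wpM2r//.
  by rewrite /cut normrM ler_piMr// indicE; case: (_ \in _); rewrite ?normr1 ?normr0.
Qed.

(** Off [G], a value of [|T f|] above [s] forces [|T (cut f (rest J))|] above [s - Y] for every [J].
    The weak type in [L^1(u)] with vanishing remainders then gives this set [u]-measure zero, and it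
    is Lebesgue null because [u] is positive almost everywhere. *)
Let distribution_A1 s : in_A1_domain f -> (Y < s)%R ->
  distribution_function (T f) s <= t%:E.
Proof.
move=> [u [uA unz fu]] Ys; apply: distribution_sum => //.
have [mT _ _] := subT; have [wu [c bc]] := uA; have [mu_ u0 _] := wu.
have [N [mN N0 NS]] := ae_foralln ae_rest.
set B := [set x | s%:E < `|T f x|] `\` G.
have mB : measurable B.
  by apply: measurableD => //; apply: measurable_superlevel; exact: mT.
have mBN : measurable (B `\` N) by exact: measurableD.
have eta0 : (0 < s - Y)%R by rewrite subr_gt0.
have sub J : B `\` N `<=` [set x | (s - Y)%:E < `|T (cut f (rest J)) x|].
  move=> x [[/= sx nGx] nNx]; rewrite ltNge; apply/negP => le_eta.
  have h : forall J, `|T f x| <= \sum_(i < J) `|T (cut f (A i)) x| + `|T (cut f (rest J)) x|.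
    by apply: contrapT => h; apply: nNx; exact: NS.
  move: sx; apply/negP; rewrite -leNgt; apply: (le_trans (h J)).
  have -> : s%:E = Y%:E + (s - Y)%:E by rewrite -EFinD addrC subrK.
  apply: leeD => //; apply: (le_trans (sum_out nGx J)).
  by rewrite lee_fin.
have mE D : measurable_fun D (EFin \o u).
  by apply: measurable_funTS; exact/measurable_EFinP.
have n1 : (0 <= A1_norm u <= A1_norm u)%R.
  by rewrite lexx andbT; apply: lb_le_inf; [exists c|move=> ? []].
have le0 J : (s - Y)%:E * \int[mu]_(x in B `\` N) (u x)%:E <=
    (C * A1_norm u ^+ k)%:E * L1_norm u (cut f (rest J)).
  have rJ : in_L1 u (cut f (rest J)).
    split; first exact: measurable_cut.
    apply: le_lt_trans fu.2; apply: ge0_le_integral => //.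
    - by move=> x _; rewrite lee_fin mulr_ge0.
    - apply/measurable_EFinP; apply: measurable_funM => //.
      by apply: measurableT_comp => //; exact: measurable_cut.
    - apply/measurable_EFinP; apply: measurable_funM => //.
      exact: measurableT_comp.
    - move=> x _; rewrite lee_fin ler_wpM2r//.
      by rewrite /cut normrM ler_piMr// indicE; case: (_ \in _); rewrite ?normr1 ?normr0.
  apply: le_trans (weak_type_A1 C0 HT uA n1 rJ eta0).
  rewrite lee_wpmul2l ?lee_fin ?(ltW eta0)//.
  apply: ge0_subset_integral => //.
  - by apply: measurable_superlevel; exact: mTf.
  - by move=> x _; rewrite lee_fin.
have I0 : \int[mu]_(x in B `\` N) (u x)%:E = 0.
  apply/eqP; rewrite eq_le integral_ge0 ?andbT; last by move=> x _; rewrite lee_fin.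
  rewrite -(lee_pmul2l (_ : (s - Y)%:E \is a fin_num)) ?lte_fin// mule0.
  have cv : (C * A1_norm u ^+ k)%:E * L1_norm u (cut f (rest J)) @[J --> \oo] --> 0.
    rewrite -(mule0 (C * A1_norm u ^+ k)%:E); apply: cvgeZl => //.
    exact: L1_rest.
  rewrite -(cvg_lim _ cv)//; apply: lime_ge; first by apply/cvg_ex; eexists; exact: cv.
  exact: nearW.
have u_abs : \int[mu]_(x in B `\` N) `|(EFin \o u) x| = 0.
  by rewrite -I0; apply: eq_integral => x _; rewrite /= ger0_norm.
have uae := (ae_eq_integral_abs mu mBN (mE _)).1 u_abs.
have upos := A1_ae_gt0 uA unz.
have [Z [mZ Z0 ZS]] := filterI uae upos.
exists (N `|` Z); split.
- exact: measurableU.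
- apply/eqP; rewrite eq_le measure_ge0 andbT.
  apply: (le_trans (measureU2 mu mN mZ)).
  by rewrite [X in X + _]N0 [X in _ + X]Z0 adde0.
- move=> x Bx; have [Nx|nNx] := pselect (N x); [by left|right; apply: ZS => /= -[h ux]].
  have [ux0] := h (conj Bx nNx).
  by rewrite ux0 ltxx in ux.
Qed.

Lemma rearrangement_superposition :
  in_A1_domain f \/ countably_subadditive T -> rearrangement (T f) t <= Y%:E.
Proof.
move=> fT; apply: rearrangement_le.
  by apply: le_trans (yY 0); rewrite big_ord0.
move=> s Ys; case: fT => h; [exact: distribution_A1|exact: distribution_countably].
Qed.

End superposition.

(** * Integrals on the line *)

Section one_dim.
Context {R : realType}.
Local Notation leb := (@lebesgue_measure R).
Local Open Scope ereal_scope.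

Lemma sum_integral_le (I : (set R)^nat) (D : set R) (F : R -> \bar R) J :
  (forall i, measurable (I i)) -> measurable D -> trivIset setT I ->
  (forall i, I i `<=` D) -> measurable_fun (D : set (measurableTypeR R)) F ->
  (forall x, D x -> 0 <= F x) ->
  \sum_(i < J) \int[leb]_(x in I i) F x <= \int[leb]_(x in D) F x.
Proof.
move=> mI mD tI ID mF F0.
have sub : \big[setU/set0]_(i <- iota 0 J) I i `<=` D.
  by rewrite -bigcup_seq => x [i _ Ix]; exact: ID Ix.
have mU : measurable (\big[setU/set0]_(i <- iota 0 J) I i).
  exact: bigsetU_measurable.
rewrite -(big_mkord xpredT (fun i => \int[leb]_(x in I i) F x)) /index_iota subn0.
rewrite -(@ge0_integral_bigsetU _ _ _ leb _ I F) ?iota_uniq//.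
- exact: ge0_subset_integral.
- exact: sub_trivIset tI.
- exact: measurable_funS sub mF.
- by move=> x /sub; exact: F0.
Qed.

Lemma measurable_inv_pos (D : set R) : measurable D -> D `<=` [set x : R | (0 < x)%R] ->
  measurable_fun (D : set (measurableTypeR R)) (fun x : R => x^-1)%R.
Proof.
move=> mD D0; apply: (eq_measurable_fun (fun x : R => powR x (-1)%R)).
  by move=> x; rewrite inE => /D0/= x0; rewrite powR_inv1// ltW.
by apply: measurable_funTS; exact: measurable_powR.
Qed.

Lemma integral_inv (a b : R) : (0 < a < b)%R ->
  \int[leb]_(x in `]a, b[) (x^-1)%:E = (ln b - ln a)%:E.
Proof.
move=> /andP[a0 ab].
rewrite integral_itv_obnd_cbnd; last first.
  apply/measurable_EFinP; apply: measurable_inv_pos => // x.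
  by rewrite /= in_itv/= => /andP[ax _]; exact: lt_trans ax.
rewrite integral_itv_bndo_bndc; last first.
  apply/measurable_EFinP; apply: measurable_inv_pos => // x.
  by rewrite /= in_itv/= => /andP[ax _]; exact: lt_le_trans ax.
have cl x : (a <= x)%R -> {for x, continuous (@ln R)}.
  by move=> ax; apply: continuous_ln; exact: lt_le_trans ax.
rewrite (@continuous_FTC2 R (fun x => x^-1)%R (@ln R) a b ab)//.
- apply: continuous_in_subspaceT => x; rewrite inE/= in_itv/= => /andP[ax _].
  by apply: inv_continuous; rewrite gt_eqF// (lt_le_trans a0).
- split.
  + move=> x; rewrite in_itv/= => /andP[ax _].
    by apply: ex_derive; apply: is_derive1_ln; exact: lt_trans ax.
  + by apply: cvg_at_right_filter; exact: cl.
  + by apply: cvg_at_left_filter; apply: cl; exact: ltW.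
- move=> x; rewrite in_itv/= => /andP[ax _]; rewrite derive1E.
  by apply: derive_val; apply: is_derive1_ln; exact: lt_trans ax.
Qed.

End one_dim.

Lemma le_expV2_le0 {R : realType} (c x : R) :
  (forall i : nat, x <= c * 2 ^- i) -> x <= 0.
Proof.
move=> h; rewrite leNgt; apply/negP => x0.
have c0 : 0 < c by have := h 0%N; rewrite expr0 invr1 mulr1; exact: lt_le_trans.
have := archi_boundP (divr_ge0 (ltW c0) (ltW x0)); set i := Num.bound _ => ci.
have := h i; rewrite ler_pdivlMr ?exprn_gt0// => xc.
have i2 : i%:R < 2 ^+ i :> R by rewrite -natrX ltr_nat ltn_expl.
have := lt_trans ci i2; rewrite ltr_pdivrMr// mulrC => /lt_le_trans/(_ xc).
by rewrite ltxx.
Qed.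

(** * Level sets of f at the values of its rearrangement *)

Section decreasing_rearrangement.
Context {R : realType} {n : nat}.
Local Notation Rn := (n.-tuple R).
Local Notation mu := (lebesgue_tuple R n).
Local Notation leb := (@lebesgue_measure R).
Variable f : Rn -> R.
Hypothesis mf : measurable_fun setT f.
Local Notation F := (rearrangement (EFin \o f)).
Local Open Scope ereal_scope.

Let mF (D : set R) : measurable D -> measurable_fun (D : set (measurableTypeR R)) F.
Proof. exact: measurable_rearrangement. Qed.

Lemma rearrangement_integral_ge (a b : R) : (a < b)%R ->
  (b - a)%:E * F b <= \int[leb]_(s in `]a, b[) F s.
Proof.
move=> ab.
have -> : (b - a)%:E * F b = \int[leb]_(s in `]a, b[) cst (F b) s.
  by rewrite integral_cst//= lebesgue_measure_itv/= lte_fin ab muleC EFinB.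
apply: ge0_le_integral => //.
- by move=> s _; exact: rearrangement_ge0.
- exact: mF.
- move=> s; rewrite /= in_itv/= => /andP[_ sb].
  by apply: rearrangement_nonincreasing; exact: ltW.
Qed.

(** An infinite value at some [s <= t] would persist on all of []0, s[] and make the integral
    infinite. *)
Lemma rearrangement_fin_num (t : R) : (0 < t)%R ->
  \int[leb]_(s in `]0%R, t[) F s < +oo ->
  forall s, (0 < s)%R -> F s \is a fin_num.
Proof.
move=> t0 It s s0; rewrite ge0_fin_numE ?rearrangement_ge0//.
wlog st : s s0 / (s <= t)%R.
  move=> h; have [st|ts] := leP s t; first exact: h.
  apply: (le_lt_trans (rearrangement_nonincreasing _ (ltW ts))); exact: h.
rewrite ltey; apply/eqP => Fs; move: It; apply/negP; rewrite -leNgt leye_eq; apply/eqP.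
apply/eqP; rewrite -leye_eq.
apply: (@le_trans _ _ (\int[leb]_(z in `]0%R, s[) F z)).
  apply: le_trans (rearrangement_integral_ge s0).
  by rewrite Fs subr0 gt0_muley// lte_fin.
apply: ge0_subset_integral => //; first exact: mF.
  by move=> z _; exact: rearrangement_ge0.
by move=> z; rewrite /= !in_itv/= => /andP[-> /lt_le_trans]; apply.
Qed.

Lemma measurable_superlevel_real (a : R) : measurable [set x | (a < `|f x|)%R].
Proof.
rewrite [X in measurable X](_ : _ = [set x | a%:E < `|(EFin \o f) x|]).
  by apply: measurable_superlevel; exact/measurable_EFinP.
by apply/seteqP; split => x /=; rewrite lte_fin.
Qed.

Lemma measurable_sublevel_real (a : R) : measurable [set x | (`|f x| <= a)%R].
Proof.
rewrite [X in measurable X](_ : _ = ~` [set x | (a < `|f x|)%R]).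
  by apply: measurableC; exact: measurable_superlevel_real.
apply/seteqP; split => x /=; first by rewrite leNgt => /negP.
by move=> /negP; rewrite -leNgt.
Qed.

Lemma mu_superlevel_real (s : R) : F s \is a fin_num ->
  mu [set x | (fine (F s) < `|f x|)%R] <= s%:E.
Proof.
move=> Fs.
have := @distribution_rearrangement _ _ (EFin \o f) s (fine (F s)).
rewrite fineK// => h; apply: le_trans (h _ (lexx _)).
  rewrite le_eqVlt; apply/orP; left; apply/eqP.
  by congr (mu _); apply/seteqP; split => x /=; rewrite lte_fin.
exact/measurable_EFinP.
Qed.

Lemma fine_rearrangement_le (s s' : R) : F s \is a fin_num -> F s' \is a fin_num ->
  (s <= s')%R -> (fine (F s') <= fine (F s))%R.
Proof. by move=> ? ? ss'; rewrite fine_le// rearrangement_nonincreasing. Qed.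

Lemma trivIset_monotone_bands {T : Type} (g : T -> R) (a : nat -> R) :
  {homo a : i j / (i <= j)%N >-> (i <= j)%R} ->
  trivIset setT (fun i => [set x | (a i < g x)%R /\ (g x <= a i.+1)%R]).
Proof.
move=> amono i j _ _ [x [[ai ai1] [aj aj1]]].
have [ij|ji|//] := ltngtP i j.
  by have := lt_le_trans aj (le_trans ai1 (amono _ _ ij)); rewrite ltxx.
by have := lt_le_trans ai (le_trans aj1 (amono _ _ ji)); rewrite ltxx.
Qed.

(** Cutting at the levels [a i], the values of the rearrangement at [r i = t * 2 ^- i], bounds the
    integral over band [i] by [a i.+1 * r i]. The rearrangement is at least [a i.+1] on []r i.+2, r
    i.+1[], an interval of length [r i / 4]; hence the constant 4. *)
Lemma integral_superlevel_le (t : R) : (0 < t)%R ->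
  \int[leb]_(s in `]0%R, t[) F s < +oo ->
  \int[mu]_(x in [set x | (fine (F t) < `|f x|)%R]) `|f x|%:E <=
  4%:E * \int[leb]_(s in `]0%R, t[) F s.
Proof.
move=> t0 It; have Ffin := rearrangement_fin_num t0 It.
pose r (i : nat) : R := (t * 2 ^- i)%R.
have r0 i : (0 < r i)%R by rewrite mulr_gt0// invr_gt0 exprn_gt0.
have rS i : r i.+1 = (r i / 2)%R by rewrite /r exprS invfM mulrCA mulrC.
have rmono i j : (i <= j)%N -> (r j <= r i)%R.
  by move=> ij; rewrite ler_pM2l// lef_pV2 ?posrE ?exprn_gt0// ler_eXn2l// ltr1n.
pose a i := fine (F (r i)).
have amono i j : (i <= j)%N -> (a i <= a j)%R.
  by move=> ij; apply: fine_rearrangement_le; [exact: Ffin..|exact: rmono].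
have a0 i : (0 <= a i)%R by apply: fine_ge0; exact: rearrangement_ge0.
pose B i := [set x | (a i < `|f x|)%R /\ (`|f x| <= a i.+1)%R].
have mB i : measurable (B i).
  apply: (@measurableI _ _ [set x | (a i < `|f x|)%R]).
    exact: measurable_superlevel_real.
  exact: measurable_sublevel_real.
(* Points above every level belong to no band; they form a null set since [r i] tends to 0. *)
pose N := \bigcap_i [set x | (a i < `|f x|)%R].
have mN : measurable N.
  by apply: bigcap_measurableType => i _; exact: measurable_superlevel_real.
have muN i : mu N <= (r i)%:E.
  apply: le_trans (mu_superlevel_real (Ffin _ (r0 i))).
  apply: le_measure; rewrite ?inE//; first exact: measurable_superlevel_real.
  by move=> x; apply.
have N0 : mu N = 0.
  have Nfin : mu N \is a fin_num.
    by rewrite ge0_fin_numE// (le_lt_trans (muN 0%N))// ltry.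
  apply/eqP; rewrite eq_le measure_ge0 andbT -(fineK Nfin) lee_fin.
  by apply: (@le_expV2_le0 _ t) => i; rewrite -lee_fin fineK//; exact: muN.
have tE : r 0%N = t by rewrite /r expr0 invr1 mulr1.
have mabs D : measurable D -> measurable_fun (D : set Rn) (fun x => `|f x|%:E).
  move=> mD; apply/measurable_EFinP; apply: measurable_funTS.
  exact: measurableT_comp.
rewrite (ge0_negligible_integral mN _ _ _ N0)//; last 2 first.
- exact: measurable_superlevel_real.
- by apply: mabs; exact: measurable_superlevel_real.
have -> : [set x | (fine (F t) < `|f x|)%R] `\` N = \bigcup_i B i.
  apply/seteqP; split=> [x [/= tx nNx]|x [i _ [ax xa]]]; last first.
    split=> /=; first by rewrite -tE; exact: le_lt_trans (amono _ _ (leq0n i)) ax.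
    by move=> /(_ i.+1 I)/=; rewrite ltNge xa.
  have ex : exists i, (`|f x| <= a i)%R.
    apply: contrapT => h; apply: nNx => i _ /=; rewrite ltNge; apply/negP => xi.
    by apply: h; exists i.
  case: (ex_minnP ex) => -[|i] xi imin.
    by move: tx; rewrite -{1}tE ltNge xi.
  exists i => //; split=> //; rewrite ltNge; apply/negP => /imin.
  by rewrite ltnn.
rewrite ge0_integral_bigcup//; last 2 first.
- by apply: mabs; exact: bigcup_measurable.
- exact: trivIset_monotone_bands.
pose J i : set R := `]r i.+2, r i.+1[%classic.
have tJ : trivIset setT J.
  move=> i j _ _ [x []]; rewrite /J/= !in_itv/= => /andP[xi ix] /andP[xj jx].
  have [ij|ji|//] := ltngtP i j.
    by have := lt_le_trans (lt_trans xi jx) (rmono i.+2 j.+1 ij); rewrite ltxx.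
  by have := lt_le_trans (lt_trans xj ix) (rmono j.+2 i.+1 ji); rewrite ltxx.
have term i : \int[mu]_(x in B i) `|f x|%:E <= 4%:E * \int[leb]_(s in J i) F s.
  apply: (@le_trans _ _ ((a i.+1)%:E * (r i)%:E)).
    apply: (@le_trans _ _ (\int[mu]_(x in B i) cst (a i.+1)%:E x)).
      apply: ge0_le_integral => //; first exact: mabs.
      by move=> x [_ xa]; rewrite lee_fin.
    rewrite integral_cst// lee_wpmul2l ?lee_fin//.
    apply: le_trans (mu_superlevel_real (Ffin _ (r0 i))).
    apply: le_measure; rewrite ?inE//; first exact: measurable_superlevel_real.
    by move=> x [].
  have rlt : (r i.+2 < r i.+1)%R by rewrite (rS i.+1) ltr_pdivrMr// ltr_pMr// ltr1n.
  have := rearrangement_integral_ge rlt.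
  rewrite -(fineK (Ffin _ (r0 i.+1))) -/(a i.+1) => h.
  apply: (@le_trans _ _ (4%:E * ((r i.+1 - r i.+2)%:E * (a i.+1)%:E))).
    by rewrite -!EFinM lee_fin !rS le_eqVlt; apply/orP; left; apply/eqP; field.
  by rewrite lee_wpmul2l// lee_fin.
apply: lime_le.
  by apply: is_cvg_nneseries => i _ _; apply: integral_ge0 => x _; rewrite lee_fin.
apply: nearW => m; rewrite big_mkord.
apply: (@le_trans _ _ (\sum_(i < m) 4%:E * \int[leb]_(s in J i) F s)).
  by apply: lee_sum => i _.
rewrite -ge0_sume_distrr; last first.
  by move=> i _; apply: integral_ge0 => x _; exact: rearrangement_ge0.
rewrite lee_wpmul2l ?lee_fin//; apply: sum_integral_le => //.
- by move=> i; exact: measurable_itv.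
- move=> i x; rewrite /J/= !in_itv/= => /andP[rx xr].
  by rewrite (lt_trans (r0 _) rx) (lt_le_trans xr)// -tE rmono.
- exact: mF.
- by move=> x _; exact: rearrangement_ge0.
Qed.

End decreasing_rearrangement.

(** * The double exponential scale *)

Section double_exponential.
Context {R : realType} {n : nat}.
Local Notation leb := (@lebesgue_measure R).
Variables (f : n.-tuple R -> R) (k : nat) (t : R).
Hypothesis t0 : 0 < t.
Local Notation F := (rearrangement (EFin \o f)).
Local Open Scope ereal_scope.

Definition log_kernel (s : R) : \bar R :=
  ((1 + ln (s / t)) ^+ k)%:E * F s * s^-1%:E.

Lemma log_kernel_ge0 s : (t < s)%R -> 0 <= log_kernel s.
Proof.
move=> ts; have s0 := lt_trans t0 ts.
rewrite /log_kernel !mule_ge0 ?rearrangement_ge0// lee_fin ?invr_ge0 ?(ltW s0)//.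
by rewrite exprn_ge0// addr_ge0// ln_ge0// ler_pdivlMr// mul1r ltW.
Qed.

Lemma measurable_log_kernel : measurable_fun (`]t, +oo[ : set (measurableTypeR R)) log_kernel.
Proof.
apply: emeasurable_funM; first apply: emeasurable_funM.
- apply/measurable_EFinP; apply: measurable_funX; apply: measurable_funD => //.
  apply: measurableT_comp => //; apply: measurable_funTS.
  exact: measurable_funM.
- exact: measurable_rearrangement.
- apply/measurable_EFinP; apply: measurable_inv_pos => // x.
  by rewrite /= in_itv/= andbT; exact: lt_trans.
Qed.

(* [ln (double_exp i / t)] doubles at each step, so that a band of level sets
   costs as much as the kernel carries on the preceding band. *)
Definition double_exp (i : nat) : R := (t * 2 ^+ (2 ^ i).-1)%R.

Lemma double_exp0 : double_exp 0 = t.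
Proof. by rewrite /double_exp expn0 expr0 mulr1. Qed.

Lemma double_exp_gt0 i : (0 < double_exp i)%R.
Proof. by rewrite mulr_gt0// exprn_gt0. Qed.

Lemma double_exp_le i j : (i <= j)%N -> (double_exp i <= double_exp j)%R.
Proof.
move=> ij; rewrite ler_pM2l// ler_eXn2l ?ltr1n//.
by rewrite -!subn1 leq_sub2r// leq_exp2l.
Qed.

Lemma double_exp_ge i : (t <= double_exp i)%R.
Proof. by rewrite -{1}double_exp0 double_exp_le. Qed.

Lemma ln2_gt0 : (0 < ln 2 :> R)%R.
Proof. by rewrite ln_gt0// ltr1n. Qed.

Lemma ln2_le1 : (ln 2 <= 1 :> R)%R.
Proof. by apply: (@le_ln1Dx R 1); lra. Qed.

Lemma ln_double_exp i : ln (double_exp i / t) = ((2 ^ i).-1%:R * ln 2)%R.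
Proof. by rewrite /double_exp mulrC mulKf ?gt_eqF// lnXn// mulr_natl. Qed.

(** The kernel gives [k] factors [2 ^+ i * ln 2], and one more is the integral of [s^-1] over the
    interval. This is the gain of one power of the logarithm. *)
Lemma integral_log_kernel_ge i : F (double_exp i.+1) \is a fin_num ->
  (fine (F (double_exp i.+1)) * (2 ^+ i * ln 2) ^+ k.+1)%:E <=
  \int[leb]_(s in `]double_exp i, double_exp i.+1[) log_kernel s.
Proof.
move=> Ffin; set l := fine _.
have l0 : (0 <= l)%R by apply: fine_ge0; exact: rearrangement_ge0.
have e2 : (0 < 2 ^ i)%N by rewrite expn_gt0.
have ii : (double_exp i < double_exp i.+1)%R.
  rewrite ltr_pM2l// ltr_eXn2l ?ltr1n// expnS mul2n -addnn.
  by rewrite -(prednK e2) addnS /= ltnS leq_addr.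
have d0 := double_exp_gt0 i.
have logE : (ln (double_exp i.+1) - ln (double_exp i) = 2 ^+ i * ln 2)%R.
  have lnE j : (ln (double_exp j) = (2 ^ j).-1%:R * ln 2 + ln t)%R.
    by rewrite -ln_double_exp -lnM ?posrE ?divr_gt0 ?double_exp_gt0// divfK// gt_eqF.
  rewrite !lnE opprD addrACA subrr addr0 -mulrBl; congr (_ * _)%R.
  have -> : ((2 ^ i.+1).-1 = (2 ^ i).-1 + 2 ^ i)%N.
    by rewrite expnS mul2n -addnn -!subn1 addnBAC.
  by rewrite natrD natrX addrAC subrr add0r.
have c0 : (0 <= (2 ^+ i * ln 2) ^+ k * l)%R.
  by rewrite mulr_ge0// exprn_ge0// mulr_ge0 ?exprn_ge0// ltW// ln2_gt0.
have mI : measurable_fun (`]double_exp i, double_exp i.+1[ : set (measurableTypeR R))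
    (fun s => s^-1%:E).
  apply/measurable_EFinP; apply: measurable_inv_pos => // x.
  by rewrite /= in_itv/= => /andP[ix _]; exact: lt_trans ix.
have -> : (l * (2 ^+ i * ln 2) ^+ k.+1)%:E =
    \int[leb]_(s in `]double_exp i, double_exp i.+1[)
      (((2 ^+ i * ln 2) ^+ k * l)%:E * s^-1%:E).
  rewrite ge0_integralZl_EFin//; last first.
    move=> x; rewrite /= in_itv/= => /andP[ix _]; rewrite lee_fin invr_ge0.
    by rewrite ltW// (lt_trans d0).
  rewrite integral_inv ?d0// logE -EFinM exprS; congr (_%:E); ring.
apply: ge0_le_integral => //.
- move=> x; rewrite /= in_itv/= => /andP[ix _]; rewrite mule_ge0// lee_fin.
  by rewrite invr_ge0 ltW// (lt_trans d0).
- exact: measurable_funeM.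
- apply: measurable_funS measurable_log_kernel => // x.
  rewrite /= !in_itv/= andbT => /andP[ix _]; exact: le_lt_trans (double_exp_ge i) ix.
move=> x; rewrite /= in_itv/= => /andP[ix xi].
have x0 := lt_trans d0 ix.
rewrite /log_kernel lee_wpmul2r ?lee_fin ?invr_ge0 ?(ltW x0)// EFinM.
apply: lee_pmul; rewrite ?lee_fin//.
- by rewrite exprn_ge0// mulr_ge0 ?exprn_ge0// ltW// ln2_gt0.
- apply: lerXn2r; rewrite ?nnegrE.
  + by rewrite mulr_ge0 ?exprn_ge0// ltW// ln2_gt0.
  + rewrite addr_ge0// ln_ge0// ler_pdivlMr// mul1r ltW//.
    exact: le_lt_trans (double_exp_ge i) ix.
  + apply: (@le_trans _ _ (1 + ln (double_exp i / t))%R).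
      (* As [ln 2 <= 1], the summand 1 of the kernel makes up for the predecessor in the exponent of
         [double_exp]. *)
      rewrite ln_double_exp -[(2 ^+ i)%R]natrX -{1}(prednK e2) -natr1 mulrDl mul1r addrC.
      by rewrite lerD2r ln2_le1.
    rewrite lerD2l ler_ln ?posrE ?divr_gt0// ler_pM2r ?invr_gt0//.
    exact: ltW.
- rewrite /l fineK//; apply: rearrangement_nonincreasing; exact: ltW.
Qed.

Lemma sum_log_kernel_le J : (forall s, (0 < s)%R -> F s \is a fin_num) ->
  \sum_(i < J) (fine (F (double_exp i.+1)) * (2 ^+ i * ln 2) ^+ k.+1)%:E <=
  \int[leb]_(s in `]t, +oo[) log_kernel s.
Proof.
move=> Ffin.
pose I i : set R := `]double_exp i, double_exp i.+1[%classic.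
apply: (@le_trans _ _ (\sum_(i < J) \int[leb]_(s in I i) log_kernel s)).
  by apply: lee_sum => i _; apply: integral_log_kernel_ge; exact/Ffin/double_exp_gt0.
apply: sum_integral_le => //.
- by move=> i; exact: measurable_itv.
- move=> i j _ _ [x []]; rewrite /I/= !in_itv/= => /andP[ix xi] /andP[jx xj].
  have [ij|ji|//] := ltngtP i j.
    by have := lt_trans xi (le_lt_trans (double_exp_le ij) jx); rewrite ltxx.
  by have := lt_trans xj (le_lt_trans (double_exp_le ji) ix); rewrite ltxx.
- move=> i x; rewrite /I/= !in_itv/= andbT => /andP[ix _].
  exact: le_lt_trans (double_exp_ge i) ix.
- exact: measurable_log_kernel.
- by move=> x; rewrite /= in_itv/= andbT; exact: log_kernel_ge0.
Qed.

End double_exponential.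

(** Admits [M = 2 ^ i.+2] in [restricted_weak_type] for a set of measure [double_exp t i.+1] and the
    share [t * 2 ^- i.+2]; in exponents, [2^(i+1) - 1 + (i+2) <= 2^(i+2)]. *)
Lemma double_exp_expV2_le {R : realType} (t : R) i : 0 < t ->
  2 ^- (2 ^ i.+2) * double_exp t i.+1 <= t * 2 ^- i.+2.
Proof.
move=> t0; rewrite /double_exp mulrCA ler_pM2l//.
rewrite -[leRHS]mul1r ler_pdivlMr ?exprn_gt0// -mulrA -exprD.
rewrite ler_pdivrMl ?exprn_gt0// mulr1 ler_eXn2l ?ltr1n//.
rewrite [leqRHS]expnS; have := ltn_expl i.+1 (ltnSn 1).
case: (2 ^ i.+1)%N => // a ia; rewrite mul2n -addnn /= addSnnS leq_add2l.
exact: leqW.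
Qed.

Lemma sum_expV2_le {R : realType} (t : R) J : 0 < t ->
  \sum_(i < J) t * 2 ^- i.+1 <= t.
Proof.
move=> t0; have -> : \sum_(i < J) t * 2 ^- i.+1 = t * (1 - 2 ^- J).
  elim: J => [|J IH]; first by rewrite big_ord0 expr0 invr1 subrr mulr0.
  rewrite big_ord_recr/= IH exprS; field.
  by rewrite expf_neq0// pnatr_eq0.
by rewrite ler_piMr ?ltW// ler_wnDr// oppr_le0 invr_ge0 exprn_ge0.
Qed.

(** One term each for the part above the level at [t], for the first band below it, and for all
    later bands. In the first, 4 comes from [integral_superlevel_le] and 2 from the share [t / 2];
    in the last, 8 is the ratio of [2 ^ i.+3] to [2 ^ i]. *)
Definition extrapolation_cst {R : realType} (n k : nat) (C : R) : R :=
  8 * C + @restricted_cst R n k.+1 C * 4 ^+ k.+1 +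
  @restricted_cst R n k.+1 C * (8 / ln 2) ^+ k.+1.

(** * Decomposition of f along the double exponential scale *)

Section bands.
Context {R : realType} {n : nat}.
Local Notation Rn := (n.-tuple R).
Local Notation mu := (lebesgue_tuple R n).
Local Notation leb := (@lebesgue_measure R).
Variables (T : (Rn -> R) -> Rn -> \bar R) (k : nat) (C : R).
Hypothesis subT : sublinear_operator T.
Hypothesis C0 : 0 < C.
Hypothesis HT : forall u : Rn -> R, A1 u -> weak_L1_bounded T u (C * A1_norm u ^+ k.+1).
Variables (f : Rn -> R) (t : R).
Hypothesis mf : measurable_fun setT f.
Hypothesis t0 : 0 < t.
Local Notation F := (rearrangement (EFin \o f)).
Local Open Scope ereal_scope.
Local Notation I0 := (\int[leb]_(s in `]0%R, t[) F s).
Local Notation I1 := (\int[leb]_(s in `]t, +oo[) log_kernel f k t s).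
Hypothesis I0fin : I0 < +oo.
Hypothesis I1fin : I1 < +oo.

Let Ffin s : (0 < s)%R -> F s \is a fin_num.
Proof. by move=> s0; apply: (rearrangement_fin_num t0 I0fin). Qed.

Let lam i := fine (F (double_exp t i)).

Let lam_ge0 i : (0 <= lam i)%R.
Proof. by apply: fine_ge0; exact: rearrangement_ge0. Qed.

Let lam_noninc i j : (i <= j)%N -> (lam j <= lam i)%R.
Proof.
move=> ij; apply: fine_rearrangement_le; [exact/Ffin/double_exp_gt0..|].
exact: double_exp_le.
Qed.

Let band i : set Rn := if i is i'.+1
  then [set x | (lam i'.+1 < `|f x|)%R /\ (`|f x| <= lam i')%R]
  else [set x | (lam 0%N < `|f x|)%R].

Let mband i : measurable (band i).
Proof.
case: i => [|i]; first exact: measurable_superlevel_real.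
apply: (@measurableI _ _ [set x | (lam i.+1 < `|f x|)%R]).
  exact: measurable_superlevel_real.
exact: measurable_sublevel_real.
Qed.

Let band_gt i x : band i x -> (lam i < `|f x|)%R.
Proof. by case: i => [//|i []]. Qed.

Let trivIset_band : trivIset setT band.
Proof.
suff lt_false i j x : (i < j)%N -> band i x -> band j x -> False.
  move=> i j _ _ [x [ix jx]]; have [ij|ji|//] := ltngtP i j.
    by have := lt_false _ _ _ ij ix jx.
  by have := lt_false _ _ _ ji jx ix.
case: j => // j ij /band_gt ix [_ xj].
by have := lt_le_trans ix (le_trans xj (@lam_noninc i j ij)); rewrite ltxx.
Qed.

Let K := @restricted_cst R n k.+1 C.

Let K_gt0 : (0 < K)%R.
Proof.
rewrite /K /restricted_cst mulr_gt0 ?addr_gt0 ?exprn_gt0//.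
by rewrite mulr_gt0// exprn_gt0// A1_cst_gt0.
Qed.

Let y i : R := if i is i'.+1 then (K * (2 ^ i'.+2)%:R ^+ k.+1 * lam i')%R
  else (8 * C * fine I0 / t)%R.

Let tau i : R := (t * 2 ^- i.+1)%R.

Let I0_ge0 : 0 <= I0.
Proof. by apply: integral_ge0 => s _; exact: rearrangement_ge0. Qed.

Let I1_ge0 : 0 <= I1.
Proof.
by apply: integral_ge0 => s; rewrite /= in_itv/= andbT; exact: log_kernel_ge0.
Qed.

Let y_ge0 i : (0 <= y i)%R.
Proof.
case: i => [|i] /=.
  by rewrite divr_ge0 ?mulr_ge0 ?fine_ge0 ?(ltW C0) ?(ltW t0).
by rewrite mulr_ge0// mulr_ge0 ?exprn_ge0// ltW.
Qed.

Let dist i : distribution_function (T (cut f (band i))) (y i) <= (tau i)%:E.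
Proof.
have [mT _ _] := subT; have mfi := measurable_cut mf (mband i).
case: i mfi => [|i] mfi.
  apply: distribution_le; first exact: mT.
  move=> s ys; have s0 : (0 < s)%R by apply: le_lt_trans ys; exact: (y_ge0 0).
  apply: (@weak_type_lebesgue _ _ T k.+1 C _ _ _ _ s (4 * fine I0)) => //.
    rewrite EFinM fineK ?ge0_fin_numE//.
    have := integral_superlevel_le mf t0 I0fin.
    rewrite -{1}(double_exp0 t) -/(lam 0) => h; apply: le_trans h.
    rewrite le_eqVlt; apply/orP; left; apply/eqP.
    rewrite [RHS]integral_mkcond; apply: eq_integral => x _; rewrite patchE.
    case: ifPn => [|/negP]; rewrite inE => bx; first by rewrite cut_in.
    by rewrite cut_out ?normr0.
  rewrite /tau expr1 mulrA ler_pdivlMr//; move: ys; rewrite ltr_pdivrMr// => /ltW.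
  by apply: le_trans; rewrite le_eqVlt; apply/orP; left; apply/eqP; ring.
apply: (@restricted_weak_type _ _ T k.+1 C _ _ _ _ (band i.+1)) => //.
- by move=> x bx; rewrite cut_in//; case: bx.
- by move=> x bx; rewrite cut_out.
- by rewrite expn_gt0.
- by rewrite mulr_gt0// invr_gt0 exprn_gt0.
(* The band lies above the level at [double_exp t i.+1], so its measure is at most that number. *)
apply: (@le_trans _ _ ((2 ^- (2 ^ i.+2))%:E * (double_exp t i.+1)%:E)).
  rewrite lee_wpmul2l ?lee_fin ?invr_ge0 ?exprn_ge0//.
  apply: le_trans (mu_superlevel_real mf (Ffin (double_exp_gt0 t0 i.+1))).
  apply: le_measure; rewrite ?inE//; first exact: measurable_superlevel_real.
  by move=> x [].
by rewrite -EFinM lee_fin double_exp_expV2_le.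
Qed.

Let Y := (extrapolation_cst n k C * (t^-1 * fine I0 + fine I1))%R.

Let y_sum J : (\sum_(i < J) y i <= Y)%R.
Proof.
(* Two extra nonnegative terms, so that the first two can always be split off. *)
apply: (@le_trans _ _ (\sum_(i < J.+2) y i)%R).
  by rewrite !big_ord_recr/= -addrA lerDl (addr_ge0 (y_ge0 J) (y_ge0 J.+1)).
have ln20 := @ln2_gt0 R.
have i00 : (0 <= t^-1 * fine I0)%R by rewrite mulr_ge0 ?invr_ge0 ?fine_ge0// ltW.
have i10 : (0 <= fine I1)%R by exact: fine_ge0.
have K4 : (0 <= K * 4 ^+ k.+1)%R.
  by apply: mulr_ge0; [exact: ltW|exact: exprn_ge0].
(* No interval of the scale precedes the first band, so its level is bounded by the mean of the
   rearrangement over []0, t[]. *)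
have y1 : (y 1 <= K * 4 ^+ k.+1 * (t^-1 * fine I0))%R.
  rewrite /= (_ : (2 ^ 2)%N%:R = 4%R)//; apply: ler_wpM2l; first exact: K4.
  rewrite /lam double_exp0 ler_pdivlMl// -lee_fin EFinM.
  rewrite !fineK ?ge0_fin_numE ?rearrangement_ge0//; last first.
    by rewrite -ge0_fin_numE ?rearrangement_ge0//; exact: Ffin.
  by have := rearrangement_integral_ge f t0; rewrite subr0.
have K8 : (0 <= K * (8 / ln 2) ^+ k.+1)%R.
  apply: mulr_ge0; first exact: ltW.
  by rewrite exprn_ge0// divr_ge0// ltW.
have y2 : (\sum_(i < J) y i.+2 <= K * (8 / ln 2) ^+ k.+1 * fine I1)%R.
  apply: (@le_trans _ _ (K * (8 / ln 2) ^+ k.+1 *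
      \sum_(i < J) lam i.+1 * (2 ^+ i * ln 2) ^+ k.+1)%R).
    rewrite mulr_sumr; apply: ler_sum => i _; rewrite /= le_eqVlt; apply/orP; left.
    apply/eqP; rewrite natrX -[LHS](mulrA K) -[RHS](mulrA K); congr (_ * _)%R.
    rewrite [RHS]mulrCA -exprMn [LHS]mulrC; congr (_ * _ ^+ _)%R.
    by rewrite !exprS; field; rewrite gt_eqF.
  rewrite ler_wpM2l// -lee_fin fineK ?ge0_fin_numE// -sumEFin.
  by apply: sum_log_kernel_le.
rewrite !big_ord_recl/= /Y /extrapolation_cst -/K.
have -> : (8 * C * fine I0 / t = 8 * C * (t^-1 * fine I0))%R by ring.
have c1 : (0 <= C * fine I1)%R by rewrite mulr_ge0// ltW.
have c2 : (0 <= K * 4 ^+ k.+1 * fine I1)%R.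
  exact: mulr_ge0.
have c3 : (0 <= K * (8 / ln 2) ^+ k.+1 * (t^-1 * fine I0))%R.
  exact: mulr_ge0.
move: y1 y2 => /= y1 y2.
rewrite (_ : \sum_(i < J) _ = \sum_(i < J) y i.+2)%R//.
move: y1 y2 c1 c2 c3; set u1 := (t^-1 * _)%R; set u2 := fine I1.
set K1 := (K * 4 ^+ _)%R; set K2 := (K * _ ^+ _)%R => y1 y2 c1 c2 c3.
rewrite !mulrDl !mulrDr; move: y1 y2; set s1 := (_ * lam 0)%R; set s2 := (\sum_(_ < _) _)%R.
move=> y1 y2; lra.
Qed.

(** Outside the bands [|f x|] is below every [lam i], and these tend to 0: [y i.+1] is at least
    [K * 2 ^+ i * lam i] and is bounded by the finite number [Y]. *)
Let f_eq0 x : ~ (\bigcup_i band i) x -> f x = 0%R.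
Proof.
move=> nx; have xlam i : (`|f x| <= lam i)%R.
  elim: i => [|i IH]; rewrite leNgt; apply/negP => h; apply: nx.
    by exists 0%N.
  by exists i.+1.
have Y0 : (0 <= Y)%R by have := y_sum 0; rewrite big_ord0.
have : (`|f x| <= 0)%R; last by rewrite normr_le0 => /eqP.
apply: (@le_expV2_le0 _ (Y / K)) => i; apply: (le_trans (xlam i)).
rewrite ler_pdivlMr ?exprn_gt0// ler_pdivlMr// mulrC.
have : (y i.+1 <= Y)%R.
  apply: le_trans (y_sum i.+2); rewrite big_ord_recr/= lerDr.
  by apply: sumr_ge0 => j _; exact: y_ge0.
apply: le_trans; rewrite /= -[leRHS](mulrA K) ler_wpM2l ?(ltW K_gt0)//.
rewrite mulrC ler_wpM2r// natrX -exprM ler_weXn2l ?ler1n//.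
by rewrite (@leq_trans i.+2)// ?leq_pmulr// -addn2 leq_addr.
Qed.

Lemma rearrangement_bound : in_A1_domain f \/ countably_subadditive T ->
  rearrangement (T f) t <= (extrapolation_cst n k C)%:E * (t^-1%:E * I0 + I1).
Proof.
move=> fT; have -> : (extrapolation_cst n k C)%:E * (t^-1%:E * I0 + I1) = Y%:E.
  have e0 : I0 = (fine I0)%:E by rewrite fineK// ge0_fin_numE.
  have e1 : I1 = (fine I1)%:E by rewrite fineK// ge0_fin_numE.
  by rewrite [in LHS]e0 [in LHS]e1.
apply: (rearrangement_superposition subT C0 HT mf mband trivIset_band f_eq0 y_sum _ _ dist fT).
- by move=> i; rewrite mulr_ge0 ?invr_ge0 ?exprn_ge0// ltW.
- by move=> J; exact: sum_expV2_le.
Qed.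

End bands.

Lemma extrapolation_cst_gt0 {R : realType} (n k : nat) (C : R) : 0 < C ->
  0 < extrapolation_cst n k C.
Proof.
move=> C0; have K0 := @restricted_cst_ge0 R n k.+1 C C0.
rewrite /extrapolation_cst ltr_wpDr//.
  by rewrite mulr_ge0// exprn_ge0// divr_ge0// ltW// ln2_gt0.
by rewrite ltr_wpDr ?mulr_gt0// mulr_ge0// exprn_ge0.
Qed.

Theorem theorem1p1 (R : realType) (n : nat) (n_gt0 : (0 < n)%N)
    (T : (n.-tuple R -> R) -> n.-tuple R -> \bar R) (k : nat) (C : R) :
  sublinear_operator T -> (0 < k)%N -> 0 < C ->
  (forall u : n.-tuple R -> R, A1 u ->
    weak_L1_bounded T u (C * A1_norm u ^+ k)) ->
  exists2 C' : R, 0 < C' &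
    forall (t : R) (f : n.-tuple R -> R), 0 < t -> measurable_fun [set: n.-tuple R] f ->
      in_A1_domain f \/ countably_subadditive T ->
      (rearrangement (T f) t <=
        C'%:E * (t^-1%:E * \int[lebesgue_measure]_(s in `]0%R, t[)
                            rearrangement (EFin \o f) s +
                 \int[lebesgue_measure]_(s in `]t, +oo[)
                   (((1 + ln (s / t)) ^+ k.-1)%:E *
                    rearrangement (EFin \o f) s * s^-1%:E)))%E.
Proof.
move=> subT k0 C0 HT; case: k k0 HT => // k _ HT.
exists (extrapolation_cst n k C); first exact: extrapolation_cst_gt0.
move=> t f t0 mf fT.
set I0 := (X in (_ <= _ * (_ * X + _))%E); set I1 := (X in (_ <= _ * (_ + X))%E).
have I0_ge0 : (0 <= I0)%E by apply: integral_ge0 => s _; exact: rearrangement_ge0.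
have I1_ge0 : (0 <= I1)%E.
  apply: integral_ge0 => s; rewrite /= in_itv/= andbT => ts.
  exact: (log_kernel_ge0 f k t0 ts).
have V0 : 0 < t^-1 by rewrite invr_gt0.
have c0 := @extrapolation_cst_gt0 R n k C C0.
(* If one of the integrals is infinite, the right-hand side is [+oo]; the other one being
   nonnegative, the sum is not the indeterminate form. *)
have [I0fin|] := ltP I0 +oo%E; last first.
  rewrite leye_eq => /eqP ->; rewrite gt0_muley ?lte_fin// addye; last first.
    by rewrite gt_eqF// (lt_le_trans _ I1_ge0)// ltNyr.
  by rewrite gt0_muley ?lte_fin// leey.
have [I1fin|] := ltP I1 +oo%E; last first.
  rewrite leye_eq => /eqP ->; rewrite addey; last first.
    by rewrite gt_eqF// (@lt_le_trans _ _ 0%E)// ?ltNyr// mule_ge0// lee_fin ltW.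
  by rewrite gt0_muley ?lte_fin// leey.
exact: rearrangement_bound.
Qed.
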